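(* Let $M$ be a smooth manifold and let $\varphi$ be a generalized polynomial structure on $M$ with minimal polynomial $P(x)=\prod_{\lambda\in\Sigma(\varphi)}(x-\lambda)^{m(\lambda)}$. Then $\varphi$ is minimal if and only if there exists a decomposition of the de Rham operator $$d=\sum_{\lambda\in\Sigma(\varphi)}d_\lambda,\qquad d_\lambda\in\mathcal{E}_M\otimes\mathbb{C},$$ such that $(\mathrm{ad}_{\widetilde\varphi}-\lambda I)^{m(\lambda)}(d_\lambda)\in\mathbb{T}M\otimes\mathbb{C}$ for every $\lambda\in\Sigma(\varphi)$.
   Context: $\mathbb{T}M=TM\oplus T^*M$ carries the inner product $\langle X+\alpha,Y+\beta\rangle=\frac12(\alpha(Y)+\beta(X))$. A generalized polynomial structure is a $C^\infty$-linear endomorphism $\varphi$ of $\mathbb{T}M$, skew-symmetric for $\langle\cdot,\cdot\rangle$, for which there is a monic $P(x)\in\mathbb{R}[x]$ of positive degree (the minimal polynomial of $\varphi$) that is the minimal polynomial of $\varphi_p$ on $\mathbb{T}_pM$ for every $p\in M$. $\Sigma(\varphi)\subset\mathbb{C}$ is the set of eigenvalues of $\varphi$ and $m(\lambda)$ the multiplicity of $\lambda$ as a root of $P$. Let $\Omega_M$ be the sheaf of differential forms, $\mathcal{E}_M$ the sheaf of $\mathbb{R}$-linear endomorphisms of $\Omega_M$ with its natural grading and graded commutator $[\psi,\chi]=\psi\chi-(-1)^{kl}\chi\psi$ for $\psi,\chi$ of degrees $k,l$, and $\mathrm{ad}_\psi(\chi)=[\psi,\chi]$; these extend $\mathbb{C}$-linearly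 to $\mathcal{E}_M\otimes\mathbb{C}$. Vector fields act on $\Omega_M$ by contraction and forms by left wedge multiplication, so sections of $\mathbb{T}M$ and of $\Omega_M$ are regarded as sections of $\mathcal{E}_M$. For a skew-symmetric endomorphism $\varphi$ of $\mathbb{T}M$, $\widetilde\varphi\in\mathcal{E}_M$ is the unique even operator with $[\widetilde\varphi,f]=0$ for all functions $f$, $[\widetilde\varphi,\mathbf{x}]=\varphi(\mathbf{x})$ for all $\mathbf{x}\in\mathbb{T}M$, and $\widetilde\varphi(1)\in\Omega^2_M$. The minimal operator is $\delta_\varphi=P(\mathrm{ad}_{\widetilde\varphi})(d)$ and the minimal torsion is $\mathcal{M}_\varphi(\mathbf{x},\mathbf{y})=[[\mathbf{x},\delta_\varphi],\mathbf{y}]$ for $\mathbf{x},\mathbf{y}\in\mathbb{T}M$. $\varphi$ is minimal if $\mathcal{M}_\varphi=0$ (equivalently, $\delta_\varphi$ is a section of $\mathbb{T}M$). *)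

(* Defs.v *)
From HB Require Import structures.
From mathcomp Require Import all_boot all_order all_algebra complex ring lra.
From mathcomp Require Import boolp classical_sets functions cardinality fsbigop.
From mathcomp Require Import reals topology normedtype landau derive.

Set Implicit Arguments.
Unset Strict Implicit.
Unset Printing Implicit Defensive.

Import Order.TTheory GRing.Theory Num.Theory.
Import numFieldNormedType.Exports.

Local Open Scope classical_set_scope.
Local Open Scope ring_scope.

Section Smooth.
Variables (R : realType) (n : nat).
Implicit Types (W : set 'rV[R]_n) (f g : 'rV[R]_n -> R).

(* Class C^k on W; only used for W open, where the derivatives of f at points
   of W depend only on the restriction of f to W. *)
Fixpoint Ck (k : nat) W f : Prop :=
  match k with
  | 0 => forall x, W x -> {for x, continuous f}
  | k'.+1 => (forall x, W x -> differentiable f x) /\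
             (forall i : 'I_n, Ck k' W ('D_(delta_mx 0 i) f))
  end.

Definition smooth_on W f := forall k, Ck k W f.

Definition smooth_map_on W (F : 'rV[R]_n -> 'rV[R]_n) :=
  forall i : 'I_n, smooth_on W (fun x => F x 0 i).

Lemma near_eq_differentiable f g x :
  {near x, f =1 g} -> differentiable f x -> differentiable g x.
Proof.
move=> fg df; have [dc fE] := (diff_locallyP x f).1 df.
have gE : g \o shift x = cst (g x) + 'd f x +o_ 0 id.
  apply/eqaddoP => e e0; move/eqaddoP: fE => /(_ e e0) fE.
  have fg0 : \forall h \near (0 : 'rV[R]_n), f (h + x) = g (h + x).
    by have := fg; rewrite (near_shift 0 x); apply: filterS => h /=; rewrite subr0.
  near=> h.
  have -> : (g \o shift x - (cst (g x) + 'd f x)) h =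
            (f \o shift x - (cst (f x) + 'd f x)) h.
    have -> : cst (g x) = cst (f x) :> ('rV[R]_n -> R).
      by apply/funext => ?; rewrite /cst (nbhs_singleton fg).
    by rewrite /= !fctE /= (near fg0 h).
  by near: h.
apply/diff_locallyP; have -> // : 'd g x = 'd f x :> (_ -> _).
  exact: diff_unique dc gE.
Unshelve. all: by end_near. Qed.

Lemma Ck_ext k W f g : open W -> (forall x, W x -> f x = g x) ->
  Ck k W f -> Ck k W g.
Proof.
move=> oW; have nW h h' : (forall x, W x -> h x = h' x) -> forall x, W x ->
    \forall y \near x, h y = h' y.
  by move=> e x Wx; apply: filterS (open_nbhs_nbhs (conj oW Wx)) => y /e.
elim: k f g => [|k IH] f g fg /=.
  move=> cf x Wx; rewrite /prop_for /continuous_at -fg//.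
  exact: cvg_trans (near_eq_cvg (nW _ _ _ fg _ Wx)) (cf x Wx).
move=> [df pf]; split=> [x Wx|i].
  by apply: near_eq_differentiable (df x Wx); apply: nW.
apply: IH (pf i) => x Wx; apply: near_eq_derive; exact: nW.
Qed.

Lemma Ck_sub k W W' f : W' `<=` W -> Ck k W f -> Ck k W' f.
Proof.
move=> sub; elim: k f => [|k IH] f /= => [cf x /sub/cf//|[df pf]].
by split=> [x /sub/df//|i]; apply: IH.
Qed.

Lemma CkW k W f : Ck k.+1 W f -> Ck k W f.
Proof.
elim: k f => [|k IH] f; first by move=> [df _] x /df /differentiable_continuous.
by move=> [df pf]; split=> // i; apply: IH.
Qed.

Lemma Ck_cst k W (a : R) : Ck k W (cst a).
Proof.
elim: k a => [|k IH] a /=; first by move=> x _; exact: cst_continuous.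
split=> [x _|i]; first exact: differentiable_cst.
have -> : 'D_(delta_mx 0 i) (cst a) = cst (0 : R) :> ('rV[R]_n -> R).
  by apply/funext => x; rewrite derive_cst.
exact: IH.
Qed.

Lemma CkD k W f g : open W -> Ck k W f -> Ck k W g ->
  Ck k W (fun x => f x + g x).
Proof.
move=> oW; elim: k f g => [|k IH] f g /=.
  by move=> cf cg x Wx; apply: continuousD; [exact: cf|exact: cg].
move=> [df pf] [dg pg]; split=> [x Wx|i].
  by apply: differentiableD; [exact: df|exact: dg].
apply: Ck_ext (IH _ _ (pf i) (pg i)) => // x Wx.
by rewrite -deriveD//; apply: diff_derivable; [exact: df|exact: dg].
Qed.

Lemma CkM k W f g : open W -> Ck k W f -> Ck k W g ->
  Ck k W (fun x => f x * g x).
Proof.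
move=> oW; elim: k f g => [|k IH] f g.
  by move=> cf cg x Wx; apply: continuousM; [exact: cf|exact: cg].
move=> Cf Cg; case: (Cf) (Cg) => [df pf] [dg pg]; split=> [x Wx|i].
  by apply: differentiableM; [exact: df|exact: dg].
apply: Ck_ext (CkD oW (IH _ _ (CkW Cf) (pg i)) (IH _ _ (CkW Cg) (pf i))) => //.
by move=> x Wx; rewrite deriveM//; apply: diff_derivable; [exact: df|exact: dg].
Qed.

Lemma smooth_ext W f g : open W -> (forall x, W x -> f x = g x) ->
  smooth_on W f -> smooth_on W g.
Proof. by move=> oW fg sf k; apply: Ck_ext (sf k). Qed.

Lemma smooth_sub W W' f : W' `<=` W -> smooth_on W f -> smooth_on W' f.
Proof. by move=> sub sf k; apply: Ck_sub (sf k). Qed.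

Lemma smooth_cst W a : smooth_on W (cst a).
Proof. by move=> k; exact: Ck_cst. Qed.

Lemma smoothD W f g : open W -> smooth_on W f -> smooth_on W g ->
  smooth_on W (fun x => f x + g x).
Proof. by move=> oW sf sg k; exact: CkD. Qed.

Lemma smoothM W f g : open W -> smooth_on W f -> smooth_on W g ->
  smooth_on W (fun x => f x * g x).
Proof. by move=> oW sf sg k; exact: CkM. Qed.

Lemma smooth_sum (I : eqType) (r : seq I) W (F : I -> 'rV[R]_n -> R) : open W ->
  (forall i, i \in r -> smooth_on W (F i)) ->
  smooth_on W (fun x => \sum_(i <- r) F i x).
Proof.
move=> oW; elim: r => [|i r IH] sF.
  have -> : (fun x => \sum_(i <- [::]) F i x) = cst 0.
    by apply/funext => x; rewrite big_nil.
  exact: smooth_cst.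
have -> : (fun x => \sum_(i <- i :: r) F i x) =
          (fun x => F i x + \sum_(i <- r) F i x).
  by apply/funext => x; rewrite big_cons.
apply: smoothD => //; first by apply: sF; rewrite mem_head.
by apply: IH => j jr; apply: sF; rewrite in_cons jr orbT.
Qed.

End Smooth.

Section Exterior.
Variables (R : realType) (n : nat).
Local Notation V := 'rV[R]_n.
Implicit Types (f g : seq V -> R) (s : seq V) (x : 'rV[R]_(n + n)).

(* An element of the exterior algebra of the dual of V is a function on finite
   sequences of vectors; its restriction to sequences of length k is its
   component of degree k, an alternating k-linear form. *)
Record altform f : Prop := AltForm {
  altform_linear : forall s1 a u v s2,
    f (s1 ++ (a *: u + v) :: s2) = a * f (s1 ++ u :: s2) + f (s1 ++ v :: s2);
  altform_alt : forall s1 u s2, f (s1 ++ u :: u :: s2) = 0 }.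

Definition del T (j : nat) (s : seq T) := take j s ++ drop j.+1 s.

Definition ev (a v : V) : R := (v *m a^T) 0 0.

Definition wedge (a : V) f s : R :=
  \sum_(0 <= j < size s) (-1) ^+ j * (ev a (nth 0 s j) * f (del j s)).

(* x = (X, a) stands for the element X + a of V + V^*, acting on forms by
   contraction with X plus left wedge multiplication by a. *)
Definition cliff x f s : R := f (lsubmx x :: s) + wedge (rsubmx x) f s.

Definition pairing (x y : 'rV[R]_(n + n)) : R :=
  2^-1 * (ev (rsubmx x) (lsubmx y) + ev (rsubmx y) (lsubmx x)).

Lemma evD a b u v : ev a (b *: u + v) = b * ev a u + ev a v.
Proof. by rewrite /ev mulmxDl -scalemxAl !mxE. Qed.

Lemma wedge_cons a f v s :
  wedge a f (v :: s) = ev a v * f s - wedge a (fun t => f (v :: t)) s.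
Proof.
rewrite /wedge /= big_nat_recl//= expr0 mul1r /del /= drop0; congr (_ + _).
rewrite -sumrN; apply: eq_bigr => j _.
by rewrite exprS mulN1r mulNr.
Qed.

Lemma wedge_linear a b f g s :
  wedge a (b *: f + g) s = b * wedge a f s + wedge a g s.
Proof.
rewrite /wedge mulr_sumr -big_split /=; apply: eq_bigr => j _.
by rewrite !fctE /= /GRing.scale /=; ring.
Qed.

Lemma altform_cons f v : altform f -> altform (fun s => f (v :: s)).
Proof.
by move=> [fl fa]; split=> [s1 *|s1 *]; [exact: (fl (v :: s1))|exact: (fa (v :: s1))].
Qed.

Lemma altform_wedge a f : altform f -> altform (wedge a f).
Proof.
move=> ff; split.
  move=> s1; elim: s1 f ff => [|w s1 IH] f ff b u v s2 /=; last first.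
    have [fl _] := ff.
    by rewrite !wedge_cons (IH _ (altform_cons w ff)) fl; ring.
  rewrite !wedge_cons evD.
  have -> : (fun t => f ((b *: u + v) :: t)) =
            b *: (fun t => f (u :: t)) + (fun t => f (v :: t)).
    by apply/funext => t; rewrite (altform_linear ff [::]).
  by rewrite wedge_linear; ring.
move=> s1; elim: s1 f ff => [|w s1 IH] f ff u s2 /=; last first.
  by rewrite wedge_cons IH ?(altform_alt ff) ?mulr0 ?subr0//; exact: altform_cons.
rewrite !wedge_cons [X in _ - (_ - X)]big1 ?subr0 ?subrr// => j _.
by rewrite (altform_alt ff [::]) !mulr0.
Qed.

Lemma cliff_linear x b f g : cliff x (b *: f + g) = b *: cliff x f + cliff x g.
Proof.
by apply/funext => s; rewrite /cliff wedge_linear !fctE /= /GRing.scale /=; ring.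
Qed.

Lemma altform_cliff x f : altform f -> altform (cliff x f).
Proof.
move=> ff; have [wl wa] := altform_wedge (rsubmx x) ff.
have [cl ca] := altform_cons (lsubmx x) ff.
by split=> [s1 b u v s2|s1 u s2]; rewrite /cliff;
  [rewrite cl wl; ring|rewrite ca wa addr0].
Qed.

Lemma altform_sum f (r : seq 'I_n) (a : 'I_n -> R) (u : 'I_n -> V) s : altform f ->
  f ((\sum_(i <- r) a i *: u i) :: s) = \sum_(i <- r) a i * f (u i :: s).
Proof.
move=> [fl _]; elim: r => [|i r IH].
  by rewrite !big_nil; have := fl [::] 1 0 0 s; rewrite scaler0 addr0 mul1r /=; lra.
by rewrite !big_cons (fl [::]) IH.
Qed.

End Exterior.

Record chart (R : realType) (n : nat) (M : topologicalType) := Chart {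
  cdom : set M;
  cmap : M -> 'rV[R]_n;
  cinv : 'rV[R]_n -> M }.

(* c is a homeomorphism from the open set cdom c onto an open set of R^n; both
   maps are total functions with irrelevant values outside of these sets. *)
Definition is_chart R n M (c : chart R n M) :=
  [/\ open (cdom c), open (cmap c @` cdom c),
      forall p, cdom c p -> cinv c (cmap c p) = p,
      forall p, cdom c p -> {for p, continuous (cmap c)} &
      forall y, (cmap c @` cdom c) y -> {for y, continuous (cinv c)}].

(* A smooth manifold of dimension n, given by an atlas. As part of the data, each
   point p comes with a chart chart_at p of the atlas around it; it serves only to
   identify the tangent space at p with R^n. *)
Record smooth_manifold (R : realType) (n : nat) := SmoothManifold {
  carrier :> topologicalType;
  manifold_T2 : hausdorff_space carrier;
  manifold_C2 : @second_countable carrier;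
  atlas : set (chart R n carrier);
  chart_at : carrier -> chart R n carrier;
  atlasP : forall c, atlas c -> is_chart c;
  chart_atP : forall p, atlas (chart_at p) /\ cdom (chart_at p) p;
  atlas_smooth : forall c c', atlas c -> atlas c' ->
    smooth_map_on (cmap c @` (cdom c `&` cdom c')) (cmap c' \o cinv c) }.

Arguments atlas {R n} _.
Arguments chart_at {R n} _ _.

(* Q(A) v *)
Definition poly_op (K : nzRingType) (V : lmodType K) (A : V -> V) (Q : {poly K})
  (v : V) : V := \sum_(i < size Q) Q`_i *: iter i A v.

(* The monic generator of the ideal of polynomials annihilating N, which acts on row
   vectors; for a size of the form n.+1 this is mxminpoly N. *)
Definition is_minpoly (F : fieldType) (m : nat) (N : 'M[F]_m) (P : {poly F}) :=
  P \is monic /\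
  forall Q, (forall v : 'rV_m, poly_op (mulmxr N) Q v = 0) <-> (P %| Q).

(* The complexification of V: (u, v) stands for u + i v. *)
Definition cplx (V : Type) : Type := (V * V)%type.

Section Complexification.
Variables (R : realType) (V : lmodType R).

HB.instance Definition _ := GRing.Zmodule.copy (cplx V) (V * V)%type.

Definition cplx_scale (l : R[i]) (w : cplx V) : cplx V :=
  let: Complex a b := l in (a *: w.1 - b *: w.2, a *: w.2 + b *: w.1).

Fact cplx_scaleA a b w : cplx_scale a (cplx_scale b w) = cplx_scale (a * b) w.
Proof.
case: a b w => [a a'] [b b'] [u v]; congr (_, _) => /=;
  rewrite scalerBr scalerDr !scalerA scalerBl scalerDl.
  by rewrite opprD [in LHS](addrC (- _)) addrACA -opprD.
by rewrite [in LHS](addrC _ (- _)) addrACA.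
Qed.
Fact cplx_scale1 : left_id 1 cplx_scale.
Proof. by move=> [u v]; rewrite /cplx_scale /= !scale1r !scale0r subr0 addr0. Qed.
Fact cplx_scaleDr : right_distributive cplx_scale +%R.
Proof.
move=> [a b] [u v] [u' v']; congr (_, _) => /=.
  by rewrite !scalerDr opprD addrACA.
by rewrite !scalerDr addrACA.
Qed.
Fact cplx_scaleDl w : {morph cplx_scale^~ w : a b / a + b}.
Proof.
move: w => [u v] [a a'] [b b']; congr (_, _) => /=.
  by rewrite !scalerDl opprD addrACA.
by rewrite !scalerDl addrACA.
Qed.

HB.instance Definition _ := GRing.Zmodule_isLmodule.Build R[i] (cplx V)
  cplx_scaleA cplx_scale1 cplx_scaleDr cplx_scaleDl.

Definition to_cplx (v : V) : cplx V := (v, 0).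

End Complexification.

Section Manifold.
Variables (R : realType) (n : nat) (M : smooth_manifold R n).
Implicit Types (c : chart R n M) (p : M) (I : seq 'I_n).
Local Notation covec := (seq 'rV[R]_n -> R).

Record opens := Opens { oset :> set M; oopen : open oset }.
Implicit Types U V W : opens.
Definition topO : opens := Opens (@openT M).
Lemma subO U : (U : set M) `<=` topO. Proof. by []. Qed.

(* The i-th coordinate vector field of the chart c at p, in the identification of
   the tangent space at p with R^n through chart_at p. *)
Definition frame c (i : 'I_n) p : 'rV[R]_n :=
  row i ('J (cmap (chart_at M p) \o cinv c) (cmap c p)).

Definition frames c I p : seq 'rV[R]_n := [seq frame c i p | i <- I].

(* f, expressed in the chart c, is smooth on U *)
Definition chart_smooth c (U : set M) (f : M -> R) :=
  smooth_on (cmap c @` (U `&` cdom c)) (f \o cinv c).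

Lemma chart_open c U : atlas M c -> open (cmap c @` (U `&` cdom c)).
Proof.
move=> /atlasP[od oi cK _ ci]; rewrite openE => y [q [Uq dq] <-].
have iq : (cmap c @` cdom c) (cmap c q) by exists q.
have nU : nbhs (cinv c (cmap c q)) U.
  by rewrite cK//; apply: open_nbhs_nbhs; split=> //; exact: oopen.
have n1 : nbhs (cmap c q) (cinv c @^-1` U) := ci _ iq _ nU.
apply: filterS (filterI n1 (open_nbhs_nbhs (conj oi iq))) => z.
move=> [/= Uz [q' dq' qz]]; exists q' => //; split=> //.
by move: Uz; rewrite -qz cK.
Qed.

Lemma chart_ext c U (f g : M -> R) : atlas M c ->
  (forall p, oset U p -> cdom c p -> f p = g p) -> chart_smooth c U f ->
  chart_smooth c U g.
Proof.
move=> ac fg; apply: smooth_ext; first exact: chart_open.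
by have [_ _ cK _ _] := atlasP ac; move=> _ [p [Up dp] <-] /=; rewrite cK// fg.
Qed.

Lemma chart_sub c (U V : set M) f : V `<=` U -> chart_smooth c U f ->
  chart_smooth c V f.
Proof. by move=> VU; apply: smooth_sub => _ [p [/VU ? ?] <-]; exists p. Qed.

Lemma chartD c U f g : atlas M c -> chart_smooth c U f -> chart_smooth c U g ->
  chart_smooth c U (fun p => f p + g p).
Proof. by move=> ac; apply: smoothD; exact: chart_open. Qed.

Lemma chartM c U f g : atlas M c -> chart_smooth c U f -> chart_smooth c U g ->
  chart_smooth c U (fun p => f p * g p).
Proof. by move=> ac; apply: smoothM; exact: chart_open. Qed.

Lemma chart_cst c (U : set M) a : chart_smooth c U (fun=> a).
Proof. exact: smooth_cst. Qed.

Lemma chart_sum (T : eqType) (r : seq T) c U (F : T -> M -> R) : atlas M c ->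
  (forall i, i \in r -> chart_smooth c U (F i)) ->
  chart_smooth c U (fun p => \sum_(i <- r) F i p).
Proof. by move=> ac; apply: smooth_sum; exact: chart_open. Qed.

(* Smooth sections over U of the bundle of exterior algebras of the cotangent
   spaces, normalised to vanish outside of U. *)
Record is_form U (w : M -> covec) : Prop := IsForm {
  form_altform : forall p, altform (w p);
  form_out : forall p, ~ oset U p -> w p = 0;
  form_smooth : forall c, atlas M c -> forall I,
    chart_smooth c U (fun p => w p (frames c I p)) }.

Definition form_pred U : {pred (M -> covec)} := fun w => `[< is_form U w >].

Lemma form_submod U : submod_closed (form_pred U).
Proof.
split.
  apply/asboolP; split=> [p|//|c ac I]; last exact: chart_cst.
  by split=> * /=; rewrite ?mulr0 ?addr0.
move=> a u v /asboolP[ua uo us] /asboolP[va vo vs]; apply/asboolP; split.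
- move=> p; have [ul uz] := ua p; have [vl vz] := va p.
  split=> [s1 b x y s2|s1 x s2]; rewrite !fctE /= /GRing.scale /=.
    by rewrite ul vl; ring.
  by rewrite uz vz mulr0 addr0.
- by move=> p Up; rewrite -[LHS]/(a *: u p + v p) uo// vo// scaler0 addr0.
- move=> c ac I; apply: chartD => //; last exact: vs.
  by apply: chartM => //; [exact: chart_cst|exact: us].
Qed.

Record dform U := DForm { form_val :> M -> covec; formP : form_val \in form_pred U }.

HB.instance Definition _ U := [isSub for (@form_val U)].
HB.instance Definition _ U := [Choice of dform U by <:].
HB.instance Definition _ U :=
  GRing.SubChoice_isSubLmodule.Build R (M -> covec) (form_pred U) (dform U)
    (form_submod U).

Lemma formE U (w : dform U) : is_form U w.
Proof. by have /asboolP := formP w. Qed.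

Lemma res_subproof U V (VU : V `<=` U) (w : dform U) :
  (fun p => if `[< oset V p >] then w p else 0) \in form_pred V.
Proof.
have [wa wo ws] := formE w; apply/asboolP; split.
- move=> p; case: ifP => _; first exact: wa.
  by split=> * /=; rewrite ?mulr0 ?addr0.
- by move=> p Vp; case: ifP => // /asboolP.
- move=> c ac I; apply: chart_ext (chart_sub VU (ws c ac I)) => // p Vp _.
  by rewrite asboolT.
Qed.

Definition res U V (VU : V `<=` U) (w : dform U) : dform V :=
  DForm (res_subproof VU w).

(* endo U = sections over U of the sheaf of R-linear endomorphisms of the sheaf of
   differential forms, i.e. endomorphisms of the restriction of that sheaf to U. *)
Record endo U := Endo {
  app : forall V, V `<=` U -> dform V -> dform V;
  app_linear : forall V (VU : V `<=` U) a (u v : dform V),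
    app VU (a *: u + v) = a *: app VU u + app VU v;
  app_natural : forall V W (VU : V `<=` U) (WU : W `<=` U) (WV : W `<=` V)
    (w : dform V), app WU (res WV w) = res WV (app VU w) }.

Lemma endo_eq U (f g : endo U) :
  (forall V (VU : V `<=` U) w, app f VU w = app g VU w) -> f = g.
Proof.
case: f g => f fl fn [g gl gn] /= fg.
have e : f = g.
  apply: functional_extensionality_dep => V.
  by apply: functional_extensionality_dep => VU; apply/funext => w.
by subst g; congr Endo; exact: Prop_irrelevance.
Qed.

Lemma formP_eq U (u v : dform U) : (forall p s, u p s = v p s) -> u = v.
Proof. by move=> uv; apply/val_inj/funext => p; apply/funext => s; exact: uv. Qed.

Lemma resE U V (VU : V `<=` U) (w : dform U) p :
  oset V p -> res VU w p = w p.
Proof. by move=> Vp /=; rewrite asboolT. Qed.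

Lemma res_linear U V (VU : V `<=` U) a (u v : dform U) :
  res VU (a *: u + v) = a *: res VU u + res VU v.
Proof.
apply: formP_eq => p s /=; rewrite !fctE.
by case: asboolP => //; rewrite scaler0 addr0.
Qed.

Lemma res0 V W (WV : W `<=` V) : res WV 0 = 0.
Proof. by apply: formP_eq => p s /=; case: ifP. Qed.

Program Definition endo0 U : endo U := @Endo U (fun _ _ _ => 0) _ _.
Next Obligation. by move=> * /=; rewrite scaler0 addr0. Qed.
Next Obligation. by move=> * /=; rewrite res0. Qed.

Program Definition endo_lin U (a : R) (f g : endo U) : endo U :=
  @Endo U (fun V VU w => a *: app f VU w + app g VU w) _ _.
Next Obligation.
by move=> U a f g V VU b u v /=; rewrite !app_linear !scalerDr !scalerA mulrC addrACA.
Qed.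
Next Obligation.
by move=> U a f g V W VU WU WV w /=; rewrite res_linear !(app_natural _ VU WU).
Qed.

Program Definition endo_id U : endo U := @Endo U (fun _ _ w => w) _ _.
Next Obligation. by []. Qed.
Next Obligation. by []. Qed.

Program Definition endo_comp U (f g : endo U) : endo U :=
  @Endo U (fun V VU w => app f VU (app g VU w)) _ _.
Next Obligation. by move=> * /=; rewrite !app_linear. Qed.
Next Obligation. by move=> U f g V W VU WU WV w /=; rewrite !(app_natural _ VU WU). Qed.

Definition endo_add U (f g : endo U) := endo_lin 1 f g.
Definition endo_scale U a (f : endo U) := endo_lin a f (endo0 U).
Definition endo_opp U (f : endo U) := endo_scale (-1) f.

HB.instance Definition _ U := gen_eqMixin (endo U).
HB.instance Definition _ U := gen_choiceMixin (endo U).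

Fact endo_addA U : associative (@endo_add U).
Proof. by move=> f g h; apply: endo_eq => V VU w /=; rewrite !scale1r addrA. Qed.
Fact endo_addC U : commutative (@endo_add U).
Proof. by move=> f g; apply: endo_eq => V VU w /=; rewrite !scale1r addrC. Qed.
Fact endo_add0 U : left_id (endo0 U) (@endo_add U).
Proof. by move=> f; apply: endo_eq => V VU w /=; rewrite scale1r add0r. Qed.
Fact endo_addN U : left_inverse (endo0 U) (@endo_opp U) (@endo_add U).
Proof.
by move=> f; apply: endo_eq => V VU w /=; rewrite scale1r addr0 scaleN1r addNr.
Qed.

HB.instance Definition _ U := GRing.isZmodule.Build (endo U)
  (@endo_addA U) (@endo_addC U) (@endo_add0 U) (@endo_addN U).

Lemma app0 U (f : endo U) V (VU : V `<=` U) : app f VU 0 = 0.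
Proof. by have := app_linear f VU (-1) 0 0; rewrite scaler0 addr0 scaleN1r addNr. Qed.

Lemma appD U (f : endo U) V (VU : V `<=` U) u v :
  app f VU (u + v) = app f VU u + app f VU v.
Proof. by have := app_linear f VU 1 u v; rewrite !scale1r. Qed.

Fact endo_mulA U : associative (@endo_comp U).
Proof. by move=> f g h; apply: endo_eq. Qed.
Fact endo_mul1l U : left_id (endo_id U) (@endo_comp U).
Proof. by move=> f; apply: endo_eq. Qed.
Fact endo_mul1r U : right_id (endo_id U) (@endo_comp U).
Proof. by move=> f; apply: endo_eq. Qed.
Fact endo_mulDl U : left_distributive (@endo_comp U) (@endo_add U).
Proof. by move=> f g h; apply: endo_eq => V VU w /=; rewrite !scale1r. Qed.
Fact endo_mulDr U : right_distributive (@endo_comp U) (@endo_add U).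
Proof. by move=> f g h; apply: endo_eq => V VU w /=; rewrite !scale1r appD. Qed.

HB.instance Definition _ U := GRing.Zmodule_isPzRing.Build (endo U)
  (@endo_mulA U) (@endo_mul1l U) (@endo_mul1r U) (@endo_mulDl U) (@endo_mulDr U).

Fact endo_scaleA U a b (f : endo U) :
  endo_scale a (endo_scale b f) = endo_scale (a * b) f.
Proof. by apply: endo_eq => V VU w /=; rewrite !addr0 scalerA. Qed.
Fact endo_scale1 U : left_id 1 (@endo_scale U).
Proof. by move=> f; apply: endo_eq => V VU w /=; rewrite addr0 scale1r. Qed.
Fact endo_scaleDr U : right_distributive (@endo_scale U) +%R.
Proof.
by move=> a f g; apply: endo_eq => V VU w /=; rewrite !addr0 !scale1r scalerDr.
Qed.
Fact endo_scaleDl U (f : endo U) : {morph (@endo_scale U)^~ f : a b / a + b}.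
Proof.
by move=> a b; apply: endo_eq => V VU w /=; rewrite !addr0 !scale1r scalerDl.
Qed.

HB.instance Definition _ U := GRing.Zmodule_isLmodule.Build R (endo U)
  (@endo_scaleA U) (@endo_scale1 U) (@endo_scaleDr U) (@endo_scaleDl U).

Program Definition endo_res U V (VU : V `<=` U) (f : endo U) : endo V :=
  @Endo V (fun W WV w => app f (subset_trans WV VU) w) _ _.
Next Obligation. by move=> * /=; rewrite app_linear. Qed.
Next Obligation. by move=> * /=; exact: app_natural. Qed.

Section Pointwise.
Variables (U : opens) (K : M -> covec -> covec).
Hypothesis K_lin : forall p a f g, K p (a *: f + g) = a *: K p f + K p g.
Hypothesis K_alt : forall p f, altform f -> altform (K p f).
Hypothesis K_smooth : forall V, V `<=` U -> forall w : dform V,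
  forall c, atlas M c -> forall I, chart_smooth c V (fun p => K p (w p) (frames c I p)).

Lemma K0 p : K p 0 = 0.
Proof. by have := K_lin p (-1) 0 0; rewrite scaler0 addr0 scaleN1r addNr. Qed.

Lemma pointwise_subproof V (VU : V `<=` U) (w : dform V) :
  (fun p => K p (w p)) \in form_pred V.
Proof.
have [wa wo ws] := formE w; apply/asboolP; split.
- by move=> p; exact: K_alt.
- by move=> p /wo ->; exact: K0.
- by move=> c ac I; exact: K_smooth.
Qed.

Program Definition pointwise : endo U :=
  @Endo U (fun V VU w => DForm (pointwise_subproof VU w)) _ _.
Next Obligation. by move=> V VU a u v /=; apply: formP_eq => p s /=; rewrite K_lin. Qed.
Next Obligation.
by move=> V W VU WU WV w /=; apply: formP_eq => p s /=; case: ifP => //; rewrite K0.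
Qed.

End Pointwise.

Definition smooth_fun (U : set M) (f : M -> R) :=
  forall c, atlas M c -> chart_smooth c U f.

(* Smooth functions acting on forms by multiplication. *)
Record sfun U := Sfun { sfun_val :> M -> R; sfunP : smooth_fun U sfun_val }.

Program Definition fun_mul U (f : sfun U) : endo U :=
  @pointwise U (fun p w => f p *: w) _ _ _.
Next Obligation. by move=> U f p a g h /=; rewrite scalerDr !scalerA mulrC. Qed.
Next Obligation.
move=> U f p w [wl wa]; split=> [s1 a u v s2|s1 u s2]; rewrite !fctE /GRing.scale/=.
  by rewrite wl; ring.
by rewrite wa mulr0.
Qed.
Next Obligation.
move=> U f V VU w c ac I.
apply: (@chartM c V (sfun_val f)) => //; last exact: form_smooth (formE w) _ _ _.
by apply: chart_sub VU _; exact: sfunP.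
Qed.

(* Smooth sections over U of TM + T^*M: the value of a section at p is (X, a) with X
   a tangent vector and a a cotangent vector at p. *)
Record is_section (U : set M) (x : M -> 'rV[R]_(n + n)) : Prop := IsSection {
  section_vec : forall c, atlas M c -> exists X : 'I_n -> M -> R,
    (forall i, chart_smooth c U (X i)) /\
    (forall p, U p -> cdom c p ->
       lsubmx (x p) = \sum_(i <- enum 'I_n) X i p *: frame c i p);
  section_covec : forall c, atlas M c -> forall i,
    chart_smooth c U (fun p => ev (rsubmx (x p)) (frame c i p)) }.

Record section U := Section_ {
  section_val :> M -> 'rV[R]_(n + n);
  sectionP : is_section U section_val }.

Program Definition act U (x : section U) : endo U :=
  @pointwise U (fun p => cliff (x p)) _ _ _.
Next Obligation. by move=> * /=; exact: cliff_linear. Qed.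
Next Obligation. by move=> * /=; exact: altform_cliff. Qed.
Next Obligation.
move=> U x V VU w c ac I /=.
have [wa wo ws] := formE w; have [xv xc] := sectionP x.
rewrite /cliff; apply: chartD => //.
  have [X [sX xX]] := xv c ac.
  apply: (@chart_ext c V (fun p =>
      \sum_(i <- enum 'I_n) X i p * w p (frames c (i :: I) p))) => //.
    by move=> p Vp dp; rewrite xX//; [rewrite altform_sum|exact: VU].
  apply: chart_sum => // i _; apply: chartM => //; last exact: ws.
  exact: chart_sub VU (sX i).
apply: (@chart_ext c V (fun p => \sum_(j <- index_iota 0 (size I))
    (-1) ^+ j * (ev (rsubmx (x p)) (nth 0 (frames c I p) j) *
       w p (frames c (del j I) p)))) => //.
  move=> p _ _; rewrite /wedge size_map; apply: eq_bigr => j _.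
  by rewrite /frames /del map_cat map_take map_drop.
apply: chart_sum => // j; rewrite mem_index_iota /= => jI.
apply: chartM => //; first exact: chart_cst.
apply: chartM => //; last exact: ws.
case: I jI => // i I jI; rewrite /frames.
under [X in chart_smooth _ _ X]funext => p do rewrite (nth_map i)//.
exact: chart_sub VU (xc _ _ _).
Qed.

Program Definition parity U : endo U :=
  @pointwise U (fun _ w s => (-1) ^+ size s * w s) _ _ _.
Next Obligation.
by move=> U p a f g /=; apply/funext => s; rewrite !fctE /GRing.scale /=; ring.
Qed.
Next Obligation.
move=> U p f [fl fa]; split=> [s1 a u v s2|s1 u s2] /=.
  by rewrite !size_cat /= fl; ring.
by rewrite fa mulr0.
Qed.
Next Obligation.
move=> U V VU w c ac I.
apply: (@chart_ext c V (fun p => (-1) ^+ size I * w p (frames c I p))) => //.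
  by move=> p _ _; rewrite size_map.
by apply: chartM => //; [exact: chart_cst|exact: form_smooth (formE w) _ _ _].
Qed.

(* The components of even (b = false) and odd (b = true) degree of f, parity U being
   the operator equal to (-1)^k on k-forms. *)
Definition part U (b : bool) (f : endo U) : endo U :=
  2^-1 *: (f + (-1) ^+ b *: (parity U * f * parity U)).

(* For f and g of degrees k and l, the sign (-1)^(kl) depends only on the parities. *)
Definition gcomm U (f g : endo U) : endo U :=
  \sum_(a : bool) \sum_(b : bool)
    (part a f * part b g - (-1) ^+ (a && b) *: (part b g * part a f)).

Definition coef U c I (w : dform U) (y : 'rV[R]_n) : R :=
  w (cinv c y) (frames c I (cinv c y)).

(* d is given in every chart of the atlas by the usual coordinate expression
   (dw)_(i_0 ... i_k) = sum_j (-1)^j d/dx^(i_j) w_(i_0 ... ^i_j ... i_k). *)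
Definition is_de_rham (d : endo topO) :=
  forall V (w : dform V) c, atlas M c ->
  forall I y, (cmap c @` (V `&` cdom c)) y ->
    coef c I (app d (@subO V) w) y =
    \sum_(j < size I) (-1) ^+ j *
      'D_(delta_mx 0 (tnth (in_tuple I) j)) (coef c (del j I) w) y.

(* The operator characterised by is_de_rham; such an operator exists and is unique. *)
Definition de_rham : endo topO := xget 0 [set d | is_de_rham d].

(* Bundle endomorphisms of TM + T^*M, preserving smooth sections. *)
Record gen_endo := GenEndo {
  gen_val :> M -> 'M[R]_(n + n);
  genP : forall U (x : M -> 'rV[R]_(n + n)),
    is_section U x -> is_section U (fun p => x p *m gen_val p) }.
Implicit Type phi : gen_endo.

Definition gapp phi U (x : section U) : section U :=
  Section_ (genP phi (sectionP x)).

Definition skew phi := forall p (x y : 'rV[R]_(n + n)),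
  pairing (x *m phi p) y = - pairing x (y *m phi p).

Definition gen_poly_structure phi (P : {poly R}) :=
  [/\ skew phi, P \is monic, (1 < size P)%N & forall p, is_minpoly (phi p) P].

Lemma form1_subproof U :
  (fun p s => if `[< oset U p >] then (nilp s)%:R else 0) \in form_pred U.
Proof.
apply/asboolP; split.
- by move=> p; case: asboolP => _; split=> [[|? ?] *|[|? ?] *] /=;
    rewrite ?mulr0 ?addr0.
- by move=> p Up; rewrite asboolF.
- move=> c ac I; apply: (@chart_ext c U (fun=> (nilp I)%:R)) => //.
    by move=> p Up _; rewrite asboolT// /nilp size_map.
  exact: chart_cst.
Qed.

Definition form1 U : dform U := DForm (form1_subproof U).

Definition has_degree U (k : nat) (w : dform U) :=
  forall p s, size s != k -> w p s = 0.

Definition is_tilde phi (psi : endo topO) :=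
  [/\ part true psi = 0,
      forall U (f : sfun U), gcomm (endo_res (@subO U) psi) (fun_mul f) = 0,
      forall U (x : section U),
        gcomm (endo_res (@subO U) psi) (act x) = act (gapp phi x) &
      has_degree 2 (app psi (@subO topO) (form1 topO))].

(* For skew phi, is_tilde phi characterises a unique operator. *)
Definition tilde phi : endo topO := xget 0 [set psi | is_tilde phi psi].

Definition ad U (f g : endo U) : endo U := gcomm f g.

Definition min_op phi P : endo topO := poly_op (ad (tilde phi)) P de_rham.

Definition min_torsion phi P U (x y : section U) : endo U :=
  gcomm (gcomm (act x) (endo_res (@subO U) (min_op phi P))) (act y).

Definition minimal phi P := forall U (x y : section U), min_torsion phi P x y = 0.

Definition spectrum phi : set R[i] :=
  [set l | exists p : M, eigenvalue (map_mx (real_complex R) (phi p)) l].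

Definition mult (P : {poly R}) (l : R[i]) : nat :=
  mup l (map_poly (real_complex R) P).

Definition ad_cplx U (f : endo U) (g : cplx (endo U)) : cplx (endo U) :=
  (ad f g.1, ad f g.2).

(* g is a section over U of the complexification of TM + T^*M *)
Definition in_TMC U (g : cplx (endo U)) :=
  exists x y : section U, g = (act x, act y).

End Manifold.

(* Main.v *)
Require Import Defs.
From HB Require Import structures.
From mathcomp Require Import all_boot all_order all_algebra complex ring lra.
From mathcomp Require Import boolp classical_sets functions cardinality fsbigop.
From mathcomp Require Import reals topology normedtype derive.

(** Write delta = P(ad)(d), with ad the bracket with tilde phi.  The sections of
    TM + T^*M are stable under ad, so the Bezout relations between the coprime
    factors (x - lambda)^m(lambda) of P show that delta is such a section if and
    only if the d_lambda exist.  It remains to see that phi is minimal if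
    and only if delta is a section.  For this, let delta be odd with
    [[x, delta], y] = 0 for all x, y.  A function f is locally the anticommutator
    of d_i and f dx_i, hence delta commutes with functions, and then each
    [x, delta] is multiplication by a function, because an operator commuting with
    the Clifford action is determined by its value on 1.  The 1-form delta(1) and
    the degree 0 parts of the delta(dx_i) are the components of a section z, and
    delta - z anticommutes with the Clifford action, which forces it to vanish.

    The existence of d and of tilde phi is not needed: the value 0 that they take
    by default satisfies the equivalence too. *)

Set Implicit Arguments.
Unset Strict Implicit.
Unset Printing Implicit Defensive.

Import Order.TTheory GRing.Theory Num.Theory.
Import numFieldNormedType.Exports.

Local Open Scope classical_set_scope.
Local Open Scope ring_scope.

(** * Primary decomposition *)

Section PolyOp.
Variables (K : fieldType) (V : lmodType K) (A : V -> V).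
Hypothesis A_linear : linear A.
Implicit Types (P Q : {poly K}) (v : V) (T : V -> Prop).

Let A_0 : A 0 = 0.
Proof. by have := A_linear (-1) 0 0; rewrite scaler0 addr0 scaleN1r addNr. Qed.

Let A_D : {morph A : u v / u + v}.
Proof. by move=> u v; have := A_linear 1 u v; rewrite !scale1r. Qed.

Let A_Z a v : A (a *: v) = a *: A v.
Proof. by have := A_linear a v 0; rewrite A_0 !addr0. Qed.

Lemma poly_op_widen m Q v : (size Q <= m)%N ->
  poly_op A Q v = \sum_(i < m) Q`_i *: iter i A v.
Proof.
move=> le; rewrite /poly_op (big_ord_widen m (fun i => Q`_i *: iter i A v) le).
rewrite [RHS](bigID (fun i : 'I_m => (i < size Q)%N)) /= [X in _ + X]big1 ?addr0//.
by move=> i; rewrite -leqNgt => ?; rewrite nth_default ?scale0r.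
Qed.

Lemma poly_op_comb a P Q v :
  poly_op A (a *: P + Q) v = a *: poly_op A P v + poly_op A Q v.
Proof.
pose N := maxn (size (a *: P + Q)) (maxn (size P) (size Q)).
have [N1 N2 N3] : [/\ size (a *: P + Q)%R <= N, size P <= N & size Q <= N]%N.
  by rewrite /N !leq_max !leqnn !orbT.
rewrite !(@poly_op_widen N)//.
rewrite scaler_sumr -big_split /=; apply: eq_bigr => i _.
by rewrite coefD coefZ scalerDl scalerA.
Qed.

Lemma poly_opD P Q v : poly_op A (P + Q) v = poly_op A P v + poly_op A Q v.
Proof. by have := poly_op_comb 1 P Q v; rewrite !scale1r. Qed.

Lemma poly_opC c v : poly_op A c%:P v = c *: v.
Proof. by rewrite (@poly_op_widen 1) ?size_polyC ?leq_b1// big_ord1 coefC. Qed.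

Lemma poly_opMX P v : poly_op A (P * 'X) v = A (poly_op A P v).
Proof.
rewrite (@poly_op_widen (size P).+1); last first.
  by rewrite (leq_trans (size_polyMleq _ _))// size_polyX addn2.
rewrite big_ord_recl coefMX scale0r add0r /poly_op (big_morph _ A_D A_0).
by apply: eq_bigr => i _; rewrite coefMX /= A_Z.
Qed.

Lemma poly_opM P Q v : poly_op A (P * Q) v = poly_op A P (poly_op A Q v).
Proof.
elim/poly_ind: P v => [|P c IH] v.
  by rewrite mul0r -[0]/(polyC 0) !poly_opC !scale0r.
rewrite mulrDl !poly_opD poly_opMX -mulrA ['X * Q]mulrC mulrA poly_opMX IH.
by rewrite mul_polyC -[c *: Q]addr0 poly_op_comb -[0]/(polyC 0) !poly_opC scale0r addr0.
Qed.

(** Passes from powers of linear factors, to which Bezout applies, to the iterated operator of the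
    theorem. *)
Lemma poly_op_XsubC_exp l m v :
  poly_op A (('X - l%:P) ^+ m) v = iter m (fun w => A w - l *: w) v.
Proof.
elim: m v => [|m IH] v; first by rewrite expr0 -[1]/(polyC 1) poly_opC scale1r.
rewrite exprS poly_opM IH -polyCN -[X in X + _]mul1r poly_opD poly_opMX.
by rewrite -[1]/(polyC 1) !poly_opC scale1r scaleNr.
Qed.

Section Invariant.
Variable T : V -> Prop.
Hypotheses (T0 : T 0) (T_lin : forall a u v, T u -> T v -> T (a *: u + v))
  (T_A : forall v, T v -> T (A v)).

Lemma poly_op_invariant Q v : T v -> T (poly_op A Q v).
Proof.
move=> Tv; have iT i : T (iter i A v) by elim: i => //= i; exact: T_A.
rewrite /poly_op; elim/big_rec: _ => // i w _; exact: T_lin.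
Qed.

(* Bezout, one factor at a time. *)
Lemma primary_decomposition l rs (m : K -> nat) v : uniq (l :: rs) ->
  T (poly_op A (\prod_(k <- l :: rs) ('X - k%:P) ^+ m k) v) ->
  exists u : K -> V, v = \sum_(k <- l :: rs) u k /\
    forall k, k \in l :: rs -> T (poly_op A (('X - k%:P) ^+ m k) (u k)).
Proof.
elim: rs l v => [|k rs IH] l v.
  move=> _ Tv; exists (fun=> v); rewrite big_seq1; split=> // k.
  by rewrite inE => /eqP->; move: Tv; rewrite big_seq1.
rewrite cons_uniq => /andP[lrs urs]; rewrite big_cons.
set p := (_ ^+ _); set q := \prod_(_ <- _) _ => Tv.
have /Bezout_eq1_coprimepP[[a b] /= ab1] : coprimep p q.
  apply: coprimep_expl; rewrite coprimep_sym coprimep_XsubC.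
  rewrite /q big_seq rootE horner_prod prodf_seq_neq0; apply/allP => i irs.
  apply/implyP => _; rewrite horner_exp hornerXsubC expf_neq0// subr_eq0.
  by apply: contraNneq lrs => ->.
(* The image of (ap)(A)v under q is a(A) applied to (pq)(A)v, hence lies in [T]. *)
have [|u [vE uT]] := IH k (poly_op A (a * p) v) urs.
  rewrite -/q -poly_opM mulrCA [q * _]mulrC poly_opM.
  exact: poly_op_invariant.
(* As ap + bq = 1, the component for l is (bq)(A)v, which p sends to b(A) applied to (pq)(A)v. *)
exists (fun j => if j == l then poly_op A (b * q) v else u j); split.
  rewrite big_cons eqxx; transitivity (poly_op A (a * p + b * q) v).
    by rewrite ab1 -[1]/(polyC 1) poly_opC scale1r.
  rewrite poly_opD addrC vE; congr (_ + _); apply: eq_big_seq => j jrs.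
  by case: eqP => // jl; rewrite -jl jrs in lrs.
move=> j; rewrite in_cons; have [-> _|_ /= /uT//] := eqVneq j l.
rewrite -/p -poly_opM mulrCA poly_opM; exact: poly_op_invariant.
Qed.

(** Polynomials in A commute, so each summand meets its own factor first, and the other factors then
    preserve [T]. *)
Lemma primary_recomposition rs (m : K -> nat) (u : K -> V) :
  (forall k, k \in rs -> T (poly_op A (('X - k%:P) ^+ m k) (u k))) ->
  T (poly_op A (\prod_(k <- rs) ('X - k%:P) ^+ m k) (\sum_(k <- rs) u k)).
Proof.
have T_D v w : T v -> T w -> T (v + w) 
  by move=> Tv Tw; have := T_lin 1 Tv Tw; rewrite scale1r.
have op_0 Q : poly_op A Q 0 = 0.
  rewrite /poly_op big1// => i _; have -> : iter i A 0 = 0; last by rewrite scaler0.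
  by elim: (nat_of_ord i) => //= j ->; exact: A_0.
have op_D Q v w : poly_op A Q (v + w) = poly_op A Q v + poly_op A Q w.
  rewrite /poly_op -big_split; apply: eq_bigr => i _ /=; rewrite -scalerDr.
  by congr (_ *: _); elim: (nat_of_ord i) => //= j ->; exact: A_D.
elim: rs => [|k rs IH] uT; first by rewrite !big_nil op_0.
rewrite !big_cons op_D; apply: T_D.
  by rewrite mulrC poly_opM; apply: poly_op_invariant; apply: uT; rewrite mem_head.
rewrite poly_opM; apply: poly_op_invariant; apply: IH => j jrs.
by apply: uT; rewrite in_cons jrs orbT.
Qed.

End Invariant.
End PolyOp.

(** * Complexification of real polynomials, roots and eigenvalues *)

Lemma map_poly_op (R : realType) (V : lmodType R) (A : V -> V) (P : {poly R}) v :
  A 0 = 0 ->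
  poly_op (fun w : cplx V => (A w.1, A w.2) : cplx V)
    (map_poly (real_complex R) P) (to_cplx v) = to_cplx (poly_op A P v).
Proof.
move=> A0; rewrite /poly_op size_map_poly.
have iE i : iter i (fun w : cplx V => (A w.1, A w.2) : cplx V) (to_cplx v) =
            to_cplx (iter i A v).
  by elim: i => //= i ->; rewrite /= A0.
have cD : {morph @to_cplx R V : u w / u + w}.
  by move=> u w; congr (_, _); rewrite addr0.
rewrite (big_morph _ cD (erefl _)); apply: eq_bigr => i _.
by rewrite iE coef_map /=; congr (_, _); rewrite /= ?scaler0 ?scale0r ?subr0 ?addr0.
Qed.

(** The list has the form [l :: rs] because a sum over the roots with prescribed value needs at
    least one summand. *)
Lemma map_poly_prod_roots (R : realType) (P : {poly R}) : P \is monic ->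
  (1 < size P)%N ->
  exists l rs, let Q := map_poly (real_complex R) P in
    [/\ uniq (l :: rs), (forall k, root Q k = (k \in l :: rs)) &
      Q = \prod_(k <- l :: rs) ('X - k%:P) ^+ mup k Q].
Proof.
move=> mP sP; set Q := map_poly _ P.
have mQ : Q \is monic by rewrite map_monic.
have [s] := closed_field_poly_normal Q; rewrite (monicP mQ) scale1r => QE.
have /hasP[l _ ls] : has (mem s) s.
  apply/hasP; case: s QE => [|l s _]; last by exists l; rewrite ?inE ?eqxx.
  rewrite big_nil => Q1; move: sP; rewrite -(size_map_poly (real_complex R)) -/Q Q1.
  by rewrite size_poly1.
have ul := undup_uniq s.
case: (undup s) (mem_undup s) ul => [|k rs] sE us.
  by move: (ls : l \in s); rewrite -sE.
exists k, rs; split=> // [j|]; first by rewrite QE root_prod_XsubC -sE.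
rewrite {1}QE.
have su : {subset s <= k :: rs} by move=> j; rewrite sE.
have muE j : mup j Q = count_mem j s by rewrite QE mu_prod_XsubC.
rewrite [RHS](eq_bigr (fun j => ('X - j%:P) ^+ count_mem j s)); last first.
  by move=> j _; rewrite -muE.
(* Each further linear factor raises the exponent of its own root by one. *)
elim: s su {muE QE ls sE} => [_|j s IH].
  by rewrite big_nil big1//= => i _; rewrite expr0.
move=> su; rewrite big_cons IH; last by move=> i si; apply: su; rewrite in_cons si orbT.
rewrite [RHS](bigD1_seq j) ?su ?mem_head//= [in LHS](bigD1_seq j) ?su ?mem_head//=.
rewrite mulrA eqxx exprS; congr (_ * _); apply: eq_bigr => i ij.
by rewrite eq_sym (negPf ij).
Qed.

Lemma poly_op_mulmxr (F : fieldType) m (N : 'M[F]_m.+1) Q (v : 'rV_m.+1) :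
  poly_op (mulmxr N) Q v = v *m horner_mx N Q.
Proof.
have NE : linear (mulmxr N : 'rV_m.+1 -> 'rV_m.+1) by exact: linearP.
elim/poly_ind: Q => [|Q c IH].
  by rewrite -[0]/(polyC 0) poly_opC scale0r horner_mx_C -scalemx1 scale0r mulmx0.
rewrite poly_opD poly_opMX// poly_opC IH rmorphD rmorphM /= horner_mx_X horner_mx_C.
by rewrite mulmxDr mul_mx_scalar mulmxA.
Qed.

(** The ideal of annihilating polynomials determines P as [mxminpoly], which commutes with field
    extensions. *)
Lemma minpoly_root (F K : fieldType) (f : {rmorphism F -> K}) m (N : 'M[F]_m) P l :
  is_minpoly N P -> eigenvalue (map_mx f N) l = root (map_poly f P) l.
Proof.
case: m N => [|m] N [mP PE].
  (* On the zero space 1 annihilates everything, so P = 1 has no root, and there is no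
     eigenvector. *)
  have /PE : forall v : 'rV_0, poly_op (mulmxr N) 1 v = 0 by move=> v; exact: thinmx0.
  rewrite dvdp1 => sP; have -> : P = 1.
    by apply/eqP; rewrite -eqp_monic ?monic1// -size_poly_eq1.
  rewrite rmorph1 (negPf (root1 _)); apply/negbTE/negP => /eigenvalueP[v _].
  by rewrite thinmx0 eqxx.
suff -> : P = mxminpoly N by rewrite -mxminpoly_map eigenvalue_root_min.
apply/eqP; rewrite -eqp_monic ?mxminpoly_monic//; apply/andP; split.
  apply/PE => v; rewrite poly_op_mulmxr mx_root_minpoly ?mulmx0//.
apply: mxminpoly_min; apply/row_matrixP => i.
by rewrite row0 rowE -poly_op_mulmxr (iffRL (PE P)).
Qed.

(** * Smoothness under change of charts *)

Section SmoothComposition.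
Variables (R : realType) (n : nat).
Implicit Types (W : set 'rV[R]_n) (f : 'rV[R]_n -> R) (G : 'rV[R]_n -> 'rV[R]_n).

Lemma smooth_differentiable W f x : smooth_on W f -> W x -> differentiable f x.
Proof. by move=> /(_ 1%N)[+ _] Wx; exact. Qed.

Lemma smooth_derive W f i : smooth_on W f -> smooth_on W ('D_(delta_mx 0 i) f).
Proof. by move=> sf k; have [_] := sf k.+1; exact. Qed.

Lemma differentiable_row G x :
  (forall i, differentiable (fun y => G y 0 i : R) x) -> differentiable G x.
Proof.
move=> dG; have -> : G = \sum_(i < n) (fun y => G y 0 i *: delta_mx 0 i).
  by apply/funext => y; rewrite fct_sumE -row_sum_delta.
by apply: differentiable_sum => i; exact: differentiableZl.
Qed.

Lemma derive_comp_row f G x i : differentiable f (G x) ->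
  (forall j, differentiable (fun y => G y 0 j : R) x) ->
  'D_(delta_mx 0 i) (f \o G) x =
  \sum_(j <- enum 'I_n) 'D_(delta_mx 0 j) f (G x) *
                        'D_(delta_mx 0 i) (fun y => G y 0 j) x.
Proof.
move=> df dG; have dG' := differentiable_row dG.
rewrite deriveE; last exact: differentiable_comp.
rewrite diff_comp//= -[X in 'd f _ X]deriveE// [X in 'd f _ X]row_sum_delta.
rewrite linear_sum big_enum /=.
apply: eq_bigr => j _; rewrite linearZ /= -deriveE// mulrC; congr (_ * _).
by rewrite derive_mx ?mxE//; exact: diff_derivable.
Qed.

(** Induction on the order of differentiability, for all f at once: by the chain rule the
    derivatives of f o G are sums of products of derivatives of G with derivatives of f composed
    with G. *)
Lemma smooth_comp W W' f G : open W -> (forall x, W x -> W' (G x)) ->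
  smooth_map_on W G -> smooth_on W' f -> smooth_on W (f \o G).
Proof.
move=> oW WG sG sf k; elim: k f sf => [|k IH] f sf.
  move=> x Wx; apply: differentiable_continuous; apply: differentiable_comp.
    by apply: differentiable_row => i; exact: smooth_differentiable (sG i) Wx.
  by apply: smooth_differentiable sf _; exact: WG.
split=> [x Wx|i].
  apply: differentiable_comp.
    by apply: differentiable_row => i; exact: smooth_differentiable (sG i) Wx.
  by apply: smooth_differentiable sf _; exact: WG.
pose F j x := ('D_(delta_mx 0 j) f \o G) x * 'D_(delta_mx 0 i) (fun y => G y 0 j) x.
apply: (@Ck_ext _ _ _ _ (fun x => \sum_(j <- enum 'I_n) F j x)) => //.
  move=> x Wx; rewrite derive_comp_row//.
    exact: smooth_differentiable sf (WG _ Wx).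
  by move=> j; exact: smooth_differentiable (sG j) Wx.
elim: (enum _) => [|j r IHr].
  under [X in Ck _ _ X]funext do rewrite big_nil.
  exact: Ck_cst.
under [X in Ck _ _ X]funext do rewrite big_cons.
apply: CkD => //; apply: CkM => //; last exact: smooth_derive.
by apply: IH; exact: smooth_derive.
Qed.

End SmoothComposition.

Section Charts.
Variables (R : realType) (n : nat) (M : smooth_manifold R n).
Implicit Types (c : chart R n M) (U : opens M).

(** Transition maps are smooth, so one chart containing U suffices as a test. *)
Lemma smooth_fun_chart c U f : atlas M c -> U `<=` cdom c -> chart_smooth c U f ->
  smooth_fun U f.
Proof.
move=> ac Uc sf c' ac'.
have [_ _ cK _ _] := atlasP ac; have [_ _ cK' _ _] := atlasP ac'.
apply: (@smooth_ext _ _ _ ((f \o cinv c) \o (cmap c \o cinv c'))).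
- exact: chart_open.
- by move=> _ [p [Up dp] <-] /=; rewrite cK' ?cK//; exact: Uc.
apply: smooth_comp sf; first exact: chart_open.
  by move=> _ [p [Up dp] <-] /=; rewrite cK'//; exists p => //; split=> //; exact: Uc.
move=> i; apply: smooth_sub (atlas_smooth ac' ac i).
by move=> _ [p [Up dp] <-]; exists p => //; split=> //; exact: Uc.
Qed.

Lemma smooth_coord c U i : atlas M c -> U `<=` cdom c ->
  smooth_fun U (fun p => cmap c p 0 i).
Proof.
move=> ac Uc c' ac'; apply: smooth_sub (atlas_smooth ac' ac i).
by move=> _ [p [Up dp] <-]; exists p => //; split=> //; exact: Uc.
Qed.

Lemma near_chartK c U y : atlas M c -> (cmap c @` (U `&` cdom c)) y ->
  \forall z \near y, cmap c (cinv c z) = z.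
Proof.
move=> ac Uy; have [_ _ cK _ _] := atlasP ac.
have oU : open (cmap c @` (U `&` cdom c)) by exact: chart_open.
by apply: filterS (open_nbhs_nbhs (conj oU Uy)) => _ [p [Up dp] <-]; rewrite cK.
Qed.

(** The tangent space at p is identified with R^n by this chart, and the change from the chart to
    itself is the identity near the image of p. *)
Lemma frame_chart_at p i : frame (chart_at M p) i p = delta_mx 0 i.
Proof.
have [ac dp] := chart_atP p; rewrite /frame /jacobian.
set c := chart_at M p.
have idE : {near cmap c p, id =1 cmap c \o cinv c}.
  have Up : (cmap c @` (topO M `&` cdom c)) (cmap c p) by exists p.
  by apply: filterS (near_chartK ac Up) => z /= ->.
have did : differentiable (id : 'rV[R]_n -> 'rV[R]_n) (cmap c p) by [].
rewrite rowE mul_rV_lin1 /= -deriveE.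
  rewrite -(near_eq_derive _ idE) derive_id//.
apply/differentiable_row => j.
apply: near_eq_differentiable (differentiable_coord _ _ _).
by apply: filterS idE => z /= <-.
Qed.

End Charts.

(** * The Clifford action *)

Section CliffordAction.
Variables (R : realType) (n : nat).
Local Notation V := 'rV[R]_n.
Implicit Types (f : seq V -> R) (s : seq V) (x y : 'rV[R]_(n + n)) (a b : V).

Lemma cliff0 x : cliff x 0 = 0.
Proof.
by have := cliff_linear x (-1) 0 0; rewrite scaler0 addr0 scaleN1r addNr.
Qed.

Lemma cliffZ x (c : R) f : cliff x (c *: f) = c *: cliff x f.
Proof. by have := cliff_linear x c f 0; rewrite addr0 cliff0 addr0. Qed.

Lemma altform_swap f u v s : altform f -> f (u :: v :: s) = - f (v :: u :: s).
Proof.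
move=> [fl fa]; apply/eqP; rewrite -addr_eq0; apply/eqP.
have D w1 w2 t : f ((w1 + w2) :: t) = f (w1 :: t) + f (w2 :: t).
  by have := fl [::] 1 w1 w2 t; rewrite scale1r mul1r.
have D' w w1 w2 t : f (w :: (w1 + w2) :: t) = f (w :: w1 :: t) + f (w :: w2 :: t).
  by have := fl [:: w] 1 w1 w2 t; rewrite scale1r mul1r.
have fa0 w : f (w :: w :: s) = 0 := fa [::] w s.
by have := fa0 (u + v); rewrite D !D' !fa0 add0r addr0.
Qed.

(** Induction on the arguments: contraction with the first vector is an antiderivation, and the
    terms with an evaluation match. *)
Lemma wedge_anticomm a b f s : wedge a (wedge b f) s = - wedge b (wedge a f) s.
Proof.
elim: s f => [|v s IH] f; first by rewrite /wedge !big_nil oppr0.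
have cE d : (fun t => wedge d f (v :: t)) =
    ev d v *: f + (-1) *: wedge d (fun t => f (v :: t)).
  by apply/funext => t; rewrite wedge_cons scaleN1r.
have wZ c (k : R) g : wedge c (k *: g) s = k * wedge c g s.
  have := wedge_linear c k g 0 s; rewrite addr0 => ->.
  by rewrite [wedge c 0 s]big1 ?addr0// => j _; rewrite !mulr0.
by rewrite !(wedge_cons _ (wedge _ _)) !cE// !wedge_linear !wZ IH; ring.
Qed.

(** The Clifford relation: contractions anticommute with each other, wedges as well, and the mixed
    terms leave the two evaluations of [pairing]. *)
Lemma cliff_anticomm x y f s : altform f ->
  cliff x (cliff y f) s + cliff y (cliff x f) s = 2 * pairing x y * f s.
Proof.
move=> ff; rewrite /cliff.
have wD c g h : wedge c (fun t => g t + h t) s = wedge c g s + wedge c h s.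
  by have := wedge_linear c 1 g h s; rewrite scale1r mul1r.
rewrite !wD !wedge_cons (altform_swap _ _ _ ff) (wedge_anticomm (rsubmx x)) /pairing.
by field.
Qed.

Lemma size_del T (j : nat) (s : seq T) : (j < size s)%N -> size (del j s) = (size s).-1.
Proof.
by case: s => //= v s js; rewrite size_cat size_take size_drop /= js subSS subnKC.
Qed.

(** Contraction lowers the degree by one and wedging raises it by one; in both cases the signs
    combine to -1. *)
Lemma cliff_parity x f s :
  (-1) ^+ size s * cliff x (fun t => (-1) ^+ size t * f t) s = - cliff x f s.
Proof.
have sgn (k : nat) : (-1) ^+ k * (-1) ^+ k = 1 :> R.
  by rewrite -exprMn mulrNN mulr1 expr1n.
rewrite /cliff mulrDr opprD; congr (_ + _).
  by rewrite /= exprS mulN1r mulNr mulrN mulrA sgn mul1r.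
rewrite /wedge mulr_sumr -sumrN; apply: eq_big_nat => j /andP[_ js].
rewrite size_del//; case: s js => //= v s js.
rewrite exprS mulN1r mulNr mulrCA; congr (- (_ * _)).
by rewrite [in LHS]mulrCA; congr (_ * _); rewrite mulrA sgn mul1r.
Qed.

End CliffordAction.

(** * Operators on forms, parities and graded commutators *)

Section Operators.
Variables (R : realType) (n : nat) (M : smooth_manifold R n).
Implicit Types (U V W : opens M).

Lemma form_ext U (u v : dform U) : (forall p s, oset U p -> u p s = v p s) -> u = v.
Proof.
move=> uv; apply: formP_eq => p s; have [/uv//|Up] := pselect (oset U p).
by rewrite (form_out (formE u) Up) (form_out (formE v) Up).
Qed.

Lemma formDE U (u v : dform U) p s : (u + v) p s = u p s + v p s.
Proof. by []. Qed.

Lemma formZE U a (u : dform U) p s : (a *: u) p s = a * u p s.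
Proof. by []. Qed.

Lemma formNE U (u : dform U) p s : (- u) p s = - u p s.
Proof. by []. Qed.

Lemma form_sumE U (I : Type) (r : seq I) (F : I -> dform U) p s :
  (\sum_(i <- r) F i) p s = \sum_(i <- r) F i p s.
Proof. by elim/big_rec2: _ => // i y1 y2 _ IH; rewrite formDE IH. Qed.

Lemma app_irr U (f : endo U) V (h h' : V `<=` U) w : app f h w = app f h' w.
Proof. by congr (app f _ w); exact: Prop_irrelevance. Qed.

Section App.
Variables (U V : opens M) (VU : V `<=` U).
Implicit Types (f g : endo U) (w : dform V).

Lemma endo_mulE f g w : app (f * g) VU w = app f VU (app g VU w).
Proof. by []. Qed.

Lemma endo_addE f g w : app (f + g) VU w = app f VU w + app g VU w.
Proof. by rewrite /= scale1r. Qed.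

Lemma endo_scaleE a f w : app (a *: f) VU w = a *: app f VU w.
Proof. by rewrite /= addr0. Qed.

Lemma endo_oppE f w : app (- f) VU w = - app f VU w.
Proof. by have := endo_scaleE (-1) f w; rewrite !scaleN1r. Qed.

Lemma endo_1E w : app (1 : endo U) VU w = w.
Proof. by []. Qed.

Lemma app_scale f a w : app f VU (a *: w) = a *: app f VU w.
Proof. by rewrite -[a *: w]addr0 app_linear app0 addr0. Qed.

End App.

Lemma app_sum U V (VU : V `<=` U) (f : endo U) (I : Type) (r : seq I)
    (F : I -> dform V) :
  app f VU (\sum_(i <- r) F i) = \sum_(i <- r) app f VU (F i).
Proof. by elim/big_rec2: _ => [|i y1 y2 _ IH]; rewrite ?app0 ?appD ?IH. Qed.

Lemma endo_scaleAl U a (f g : endo U) : a *: f * g = a *: (f * g).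
Proof. by apply: endo_eq => V VU w; rewrite !(endo_mulE, endo_scaleE). Qed.

Lemma endo_scaleAr U a (f g : endo U) : f * (a *: g) = a *: (f * g).
Proof. by apply: endo_eq => V VU w; rewrite !(endo_mulE, endo_scaleE) app_scale. Qed.

Lemma parityK U : parity U * parity U = 1.
Proof.
apply: endo_eq => V VU w; apply: form_ext => p s Vp /=.
by rewrite mulrA -exprMn mulrNN mulr1 expr1n mul1r.
Qed.

(** Conjugation by the parity involution encodes homogeneity, so that parities add in products. *)
Definition has_parity U (b : bool) (f : endo U) :=
  parity U * f * parity U = (-1) ^+ b *: f.

Lemma signr_sq (b : bool) : (-1) ^+ b * (-1) ^+ b = 1 :> R.
Proof. by rewrite -exprMn mulrNN mulr1 expr1n. Qed.

Lemma half_double (L : lmodType R) (v : L) : 2^-1 *: (v + v) = v.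
Proof.
by rewrite -mulr2n -[X in _ *: X]scaler_nat scalerA mulVf ?scale1r// pnatr_eq0.
Qed.

Lemma part_eq U b (f : endo U) : has_parity b f -> part b f = f.
Proof. by rewrite /part => ->; rewrite scalerA signr_sq scale1r half_double. Qed.

Lemma part_neq U b (f : endo U) : has_parity b f -> part (~~ b) f = 0.
Proof.
rewrite /part => ->; rewrite scalerA signrN mulNr signr_sq scaleN1r subrr.
exact: scaler0.
Qed.

Lemma part_sum U (f : endo U) : part false f + part true f = f.
Proof.
rewrite /part -scalerDr expr0 expr1 scale1r scaleN1r addrACA subrr addr0.
exact: half_double.
Qed.

Lemma gcomm_parity U a b (f g : endo U) : has_parity a f -> has_parity b g ->
  gcomm f g = f * g - (-1) ^+ (a && b) *: (g * f).
Proof.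
move=> fa gb; have := part_neq fa; have := part_neq gb.
have := part_eq fa; have := part_eq gb.
by rewrite /gcomm !big_bool; case: a fa; case: b gb => _ _ /= -> -> -> ->;
  rewrite !(mul0r, mulr0, oppr0, scaler0, subr0, addr0, add0r).
Qed.

(** Against an even f the sign is +1 for both components of g, so g may be inhomogeneous. *)
Lemma gcomm_even U (f g : endo U) : part true f = 0 -> gcomm f g = f * g - g * f.
Proof.
move=> f1; have := part_sum f; rewrite f1 addr0 => fE.
rewrite -[in RHS](part_sum g) /gcomm !big_bool f1 fE /= !expr0 !scale1r.
rewrite !(mul0r, mulr0, oppr0, subr0, add0r) mulrDr mulrDl opprD.
by rewrite [RHS]addrACA scaler0 oppr0 add0r addrC.
Qed.

Lemma even_has_parity U (f : endo U) : part true f = 0 -> has_parity false f.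
Proof.
move/eqP; rewrite /part scaler_eq0 invr_eq0 pnatr_eq0 /= expr1 scaleN1r subr_eq0.
by rewrite /has_parity expr0 scale1r => /eqP.
Qed.

Lemma has_parity_lin U b a (f g : endo U) :
  has_parity b f -> has_parity b g -> has_parity b (a *: f + g).
Proof.
rewrite /has_parity => fb gb.
rewrite mulrDr mulrDl endo_scaleAr endo_scaleAl fb gb scalerDr !scalerA.
by rewrite [a * _]mulrC.
Qed.

Lemma has_parity0 U b : has_parity b (0 : endo U).
Proof. by rewrite /has_parity mulr0 mul0r scaler0. Qed.

Lemma has_parityD U b (f g : endo U) :
  has_parity b f -> has_parity b g -> has_parity b (f + g).
Proof. by move=> fb gb; rewrite -[f]scale1r; exact: has_parity_lin. Qed.

Lemma has_parityN U b (f : endo U) : has_parity b f -> has_parity b (- f).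
Proof.
by move=> fb; rewrite -scaleN1r -[_ *: f]addr0; apply: has_parity_lin (has_parity0 _ _).
Qed.

Lemma has_parityM U a b (f g : endo U) :
  has_parity a f -> has_parity b g -> has_parity (a (+) b) (f * g).
Proof.
rewrite /has_parity => fa gb.
transitivity ((parity U * f * parity U) * (parity U * g * parity U)).
  by rewrite !mulrA -[_ * parity U * parity U]mulrA parityK mulr1.
by rewrite fa gb endo_scaleAr endo_scaleAl scalerA -signr_addb addbC.
Qed.

Lemma act_odd U (x : section U) : has_parity true (act x).
Proof.
apply: endo_eq => V VU w; apply: form_ext => p s Vp.
by rewrite endo_scaleE formZE expr1 mulN1r -cliff_parity.
Qed.

Lemma fun_mulC U (f : sfun U) (x : section U) : fun_mul f * act x = act x * fun_mul f.
Proof.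
by apply: endo_eq => V VU w; apply: form_ext => p s Vp /=; rewrite cliffZ.
Qed.

Lemma act_anticomm U (x y : section U) V (VU : V `<=` U) (w : dform V) p s :
  app (act x * act y + act y * act x) VU w p s = 2 * pairing (x p) (y p) * w p s.
Proof.
rewrite endo_addE formDE !endo_mulE /= cliff_anticomm//.
exact: form_altform (formE w) p.
Qed.

End Operators.

(** * Sections of TM + T^*M and their action on forms *)

Section Sections.
Variables (R : realType) (n : nat) (M : smooth_manifold R n).
Implicit Types (c : chart R n M) (U V : opens M).

Lemma ev_row (a : 'I_n -> R) (v : 'rV[R]_n) :
  ev (\row_j a j) v = \sum_(j <- enum 'I_n) v 0 j * a j.
Proof. by rewrite /ev mxE big_enum; apply: eq_bigr => j _; rewrite !mxE. Qed.

Lemma ev0 (v : 'rV[R]_n) : ev 0 v = 0.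
Proof. by rewrite /ev trmx0 mulmx0 mxE. Qed.

Lemma ev_linear_l (b : R) (a a' v : 'rV[R]_n) :
  ev (b *: a + a') v = b * ev a v + ev a' v.
Proof. by rewrite /ev linearD linearZ /= mulmxDr -scalemxAr !mxE. Qed.

Lemma altform_cons0 (f : seq 'rV[R]_n -> R) s : altform f -> f (0 :: s) = 0.
Proof.
by move=> [fl _]; have := fl [::] (-1) 0 0 s; rewrite scaler0 addr0 mulN1r addNr.
Qed.

Lemma cliff_combl (b : R) (x y : 'rV[R]_(n + n)) f s : altform f ->
  cliff (b *: x + y) f s = b * cliff x f s + cliff y f s.
Proof.
move=> [fl _]; rewrite /cliff !linearP /= (fl [::]).
have wD a a' : wedge (b *: a + a') f s = b * wedge a f s + wedge a' f s.
  rewrite /wedge mulr_sumr -big_split /=; apply: eq_bigr => j _.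
  by rewrite ev_linear_l mulrDl mulrDr -mulrA mulrCA.
by rewrite wD; ring.
Qed.

Lemma wedge0 f s : wedge (0 : 'rV[R]_n) f s = 0.
Proof. by apply: big1 => j _; rewrite ev0 mul0r mulr0. Qed.

Lemma cliff_vec (v : 'rV[R]_n) f s : cliff (row_mx v 0) f s = f (v :: s).
Proof. by rewrite /cliff row_mxKl row_mxKr wedge0 addr0. Qed.

Lemma cliff_covec (a : 'rV[R]_n) f s : altform f ->
  cliff (row_mx 0 a) f s = wedge a f s.
Proof. by move=> ff; rewrite /cliff row_mxKl row_mxKr altform_cons0// add0r. Qed.

Lemma cliff_nil (x : 'rV[R]_(n + n)) f : cliff x f [::] = f [:: lsubmx x].
Proof. by rewrite /cliff /wedge big_nil addr0. Qed.

Lemma form_basis U (w : dform U) p v :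
  w p [:: v] = \sum_(j <- enum 'I_n) v 0 j * w p [:: delta_mx 0 j].
Proof.
rewrite {1}[v]row_sum_delta -(big_enum _ _ _ (fun j => v 0 j *: delta_mx 0 j)).
by rewrite altform_sum//; exact: form_altform (formE w) p.
Qed.

Program Definition section_comb U (b : R) (x y : section U) : section U :=
  @Section_ _ _ _ U (fun p => b *: x p + y p) _.
Next Obligation.
move=> U b x y; have [xv xc] := sectionP x; have [yv yc] := sectionP y.
split=> c ac.
  have [X [sX xX]] := xv c ac; have [Y [sY yY]] := yv c ac.
  exists (fun i p => b * X i p + Y i p); split=> [i|p Up dp].
    apply: chartD => //; apply: (@chartM _ _ _ c U (fun=> b)) => //.
    exact: chart_cst.
  rewrite linearD linearZ /= xX// yY// scaler_sumr -big_split /=.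
  by apply: eq_bigr => i _; rewrite scalerDl scalerA.
move=> i; apply: (@chart_ext _ _ _ c U (fun p =>
    b * ev (rsubmx (x p)) (frame c i p) + ev (rsubmx (y p)) (frame c i p))) => //.
  by move=> p _ _; rewrite linearD linearZ /= ev_linear_l.
apply: chartD => //; last exact: yc.
by apply: (@chartM _ _ _ c U (fun=> b)) => //; [exact: chart_cst|exact: xc].
Qed.

Lemma act_comb U b (x y : section U) : act (section_comb b x y) = b *: act x + act y.
Proof.
apply: endo_eq => V VU w; apply: form_ext => p s Vp.
rewrite endo_addE endo_scaleE formDE formZE /= cliff_combl//.
exact: form_altform (formE w) p.
Qed.

Program Definition section0 U : section U := @Section_ _ _ _ U (fun=> 0) _.
Next Obligation.
move=> U; split=> c ac.
  exists (fun _ _ => 0); split=> [i|p _ _]; first exact: chart_cst.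
  by rewrite linear0 big1// => i _; rewrite scale0r.
move=> i; apply: (@chart_ext _ _ _ c U (fun=> 0)) => //; last exact: chart_cst.
by move=> p _ _; rewrite linear0 ev0.
Qed.

Lemma act0 U : act (section0 U) = 0.
Proof.
apply: endo_eq => V VU w; apply: form_ext => p s Vp /=.
rewrite /cliff linear0 linear0 wedge0 addr0 altform_cons0//.
exact: form_altform (formE w) p.
Qed.

Program Definition section_scale U (f : sfun U) (x : section U) : section U :=
  @Section_ _ _ _ U (fun p => f p *: x p) _.
Next Obligation.
move=> U f x; have [xv xc] := sectionP x; have fs := sfunP f; split=> c ac.
  have [X [sX xX]] := xv c ac; exists (fun i p => f p * X i p); split=> [i|p Up dp].
    by apply: (@chartM _ _ _ c U f) => //; exact: fs.
  rewrite linearZ /= xX// scaler_sumr; apply: eq_bigr => i _.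
  by rewrite scalerA.
move=> i; apply: (@chart_ext _ _ _ c U (fun p =>
    f p * ev (rsubmx (x p)) (frame c i p))) => //.
  move=> p _ _; rewrite linearZ /= -[f p *: _]addr0 ev_linear_l ev0 addr0.
  by [].
by apply: (@chartM _ _ _ c U f) => //; [exact: fs|exact: xc].
Qed.

Program Definition section_res U V (VU : V `<=` U) (x : section U) : section V :=
  @Section_ _ _ _ V x _.
Next Obligation.
move=> U V VU x; have [xv xc] := sectionP x; split=> c ac.
  have [X [sX xX]] := xv c ac; exists X; split=> [i|p /VU]; last exact: xX.
  exact: chart_sub VU (sX i).
by move=> i; apply: chart_sub VU _; exact: xc.
Qed.

Lemma endo_res_act U V (VU : V `<=` U) (x : section U) :
  endo_res VU (act x) = act (section_res VU x).
Proof. by apply: endo_eq => W WV w; apply: formP_eq. Qed.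

(** Only the component of degree 1 of w enters. *)
Program Definition form_section U (w : dform U) : section U :=
  @Section_ _ _ _ U (fun p => row_mx 0 (\row_j w p [:: delta_mx 0 j])) _.
Next Obligation.
move=> U w; split=> c ac.
  exists (fun _ _ => 0); split=> [i|p _ _]; first exact: chart_cst.
  by rewrite row_mxKl big1// => i _; rewrite scale0r.
move=> i; apply: chart_ext (form_smooth (formE w) ac [:: i]) => // p _ _.
by rewrite row_mxKr ev_row [LHS]form_basis.
Qed.

Lemma form_sectionE U (w : dform U) p v : ev (rsubmx (form_section w p)) v = w p [:: v].
Proof. by rewrite /= row_mxKr ev_row -form_basis. Qed.

Lemma pairing_vec (u v : 'rV[R]_n) : pairing (row_mx u 0) (row_mx v 0) = 0.
Proof. by rewrite /pairing !row_mxKr !ev0 addr0 mulr0. Qed.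

Lemma ev_0 (a : 'rV[R]_n) : ev a 0 = 0.
Proof. by rewrite /ev mul0mx mxE. Qed.

Lemma pairing_vecl (v : 'rV[R]_n) x : 2 * pairing (row_mx v 0) x = ev (rsubmx x) v.
Proof. by rewrite /pairing row_mxKr row_mxKl ev0; field. Qed.

Lemma pairing_covecl (a : 'rV[R]_n) x : 2 * pairing (row_mx 0 a) x = ev a (lsubmx x).
Proof. by rewrite /pairing row_mxKr row_mxKl ev_0; field. Qed.

Lemma act_anticomm_fun U (x y : section U) (h : sfun U) :
  (forall p, oset U p -> 2 * pairing (x p) (y p) = h p) ->
  act x * act y + act y * act x = fun_mul h.
Proof.
move=> xyh; apply: endo_eq => V VU w; apply: form_ext => p s Vp.
by rewrite act_anticomm xyh//; exact: VU.
Qed.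

Lemma act_anticomm_cst U (x y : section U) (k : R) :
  (forall p, oset U p -> 2 * pairing (x p) (y p) = k) ->
  act x * act y + act y * act x = k *: (1 : endo U).
Proof.
move=> xyk; apply: endo_eq => V VU w; apply: form_ext => p s Vp.
by rewrite act_anticomm xyk ?endo_scaleE//; exact: VU.
Qed.

End Sections.

(** Expand the first argument in the [b i]; each contraction is alternating and satisfies the same
    hypothesis. *)
Lemma altform_span (R : realType) n (b : 'I_n -> 'rV[R]_n) f :
  (forall v, exists a : 'I_n -> R, v = \sum_(i <- enum 'I_n) a i *: b i) ->
  altform f -> (forall I, f [seq b i | i <- I] = 0) -> forall s, f s = 0.
Proof.
move=> span ff fb s; elim: s f ff fb => [|v s IH] f ff fb; first exact: (fb [::]).
have [a ->] := span v; rewrite altform_sum// big1// => i _.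
rewrite (IH (fun t => f (b i :: t))) ?mulr0//; first exact: altform_cons.
by move=> I; exact: (fb (i :: I)).
Qed.

(** * The de Rham operator and coordinate frames *)

Section DeRham.
Variables (R : realType) (n : nat) (M : smooth_manifold R n).
Implicit Types (c : chart R n M) (U V : opens M).
Hypothesis d_de_rham : is_de_rham (de_rham M).

Lemma frame_at_span p v : exists a : 'I_n -> R,
  v = \sum_(i <- enum 'I_n) a i *: frame (chart_at M p) i p.
Proof.
exists (fun i => v 0 i); rewrite {1}[v]row_sum_delta big_enum /=.
by apply: eq_bigr => i _; rewrite frame_chart_at.
Qed.

(** On the frame of [chart_at], which spans at p, dw on k vectors involves w on k - 1 vectors
    only. *)
Lemma de_rham_odd : has_parity true (de_rham M).
Proof.
apply: endo_eq => V VU w; apply: form_ext => p s Vp.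
apply/eqP; rewrite -subr_eq0; apply/eqP.
set u := app _ VU w; set u' := app _ VU w.
have uu : altform ((u - u') p) by exact: form_altform (formE (u - u')) p.
rewrite -[LHS]/((u - u') p s); apply: altform_span uu _ s; first exact: frame_at_span.
move=> I; set c := chart_at M p; have [ac dp] := chart_atP p; rewrite -/c in ac dp.
have [_ _ cK _ _] := atlasP ac.
have yV : (cmap c @` (V `&` cdom c)) (cmap c p) by exists p.
have dE (w' : dform V) J : app (de_rham M) VU w' p [seq frame c i p | i <- J] =
    \sum_(j < size J) (-1) ^+ j *
      'D_(delta_mx 0 (tnth (in_tuple J) j)) (coef c (del j J) w') (cmap c p).
  rewrite (app_irr _ VU (@subO _ _ _ V)) -(d_de_rham w' ac J yV) /coef cK//.
have coefE J : coef c J (app (parity (topO M)) VU w) = (-1) ^+ size J *: coef c J w.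
  by apply/funext => y; rewrite /coef /= size_map.
rewrite [LHS]formDE formNE {}/u {}/u' endo_scaleE formZE expr1 mulN1r opprK.
rewrite [X in X + _]/= size_map -/c.
rewrite -[app (de_rham M) VU _ p _]/(app (de_rham M) VU (app (parity _) VU w) p _).
rewrite !dE mulr_sumr -big_split big1// => j _ /=.
have js := ltn_ord j.
rewrite coefE size_del// deriveZ; last first.
  apply: diff_derivable.
  exact: smooth_differentiable (form_smooth (formE w) ac (del j I)) yV.
case: I j js => [|i I] j js; first by case: j js.
rewrite /GRing.scale /= exprS mulN1r mulNr mulrCA [X in - (_ * X)]mulrA.
by rewrite -exprMn mulrNN mulr1 expr1n mul1r addNr.
Qed.

Section Coordinates.
Variables (c : chart R n M) (U : opens M).
Hypotheses (ac : atlas M c) (Uc : (U : set M) `<=` cdom c).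

Definition coord_fun i : sfun U := Sfun (smooth_coord i ac Uc).

(** The differential dx_i; defined through d, it is compatible with restriction by naturality. *)
Definition dcoord i : dform U :=
  app (de_rham M) (@subO _ _ _ U)
    (app (fun_mul (coord_fun i)) (@subset_refl _ U) (form1 U)).

Lemma dcoord_frame i j p : oset U p -> dcoord i p [:: frame c j p] = (i == j)%:R.
Proof.
move=> Up; have [_ _ cK _ _] := atlasP ac.
have yU : (cmap c @` (U `&` cdom c)) (cmap c p).
  by exists p => //; split=> //; exact: Uc.
pose w := app (fun_mul (coord_fun i)) (@subset_refl _ U) (form1 U).
have := d_de_rham w ac [:: j] yU.
rewrite {1}/coef cK; last exact: Uc.
rewrite /dcoord /= => ->.
rewrite big_ord1 expr0 mul1r /del /= (tnth_nth j) /=.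
(* Near the point the differentiated coefficient is the i-th coordinate function. *)
have near_coord : \forall y \near cmap c p,
    coef c [::] w y = y 0 i.
  have oU : open (cmap c @` (U `&` cdom c)) by exact: chart_open.
  apply: filterS (open_nbhs_nbhs (conj oU yU)) => _ [q [Uq dq] <-].
  rewrite /coef /= !fctE /= cK// asboolT//.
  by rewrite /GRing.scale /= mulr1.
rewrite (near_eq_derive _ near_coord).
have -> : 'D_(delta_mx 0 j) (fun y : 'rV[R]_n => y 0 i) (cmap c p) =
          'D_(delta_mx 0 j) (id : 'rV[R]_n -> 'rV[R]_n) (cmap c p) 0 i.
  by rewrite derive_mx ?mxE//; exact: derivable_id.
by rewrite derive_id mxE /= eq_sym.
Qed.

(** Duality of differentials and frame reads F D = 1; for square matrices D F = 1 follows, which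
    expands v. *)
Lemma frame_dual p v : oset U p ->
  v = \sum_(i <- enum 'I_n) dcoord i p [:: v] *: frame c i p.
Proof.
move=> Up; pose D := \matrix_(j, i) dcoord i p [:: delta_mx 0 j].
pose F := \matrix_i frame c i p.
have dE u i : dcoord i p [:: u] = (u *m D) 0 i.
  by rewrite form_basis mxE big_enum; apply: eq_bigr => j _; rewrite !mxE.
have FD : F *m D = 1%:M.
  apply/matrixP => i j; have := dE (frame c i p) j; rewrite dcoord_frame// !mxE eq_sym.
  by move=> ->; apply: eq_bigr => k _; rewrite !mxE.
have DF := mulmx1C FD.
rewrite -{1}[v]mulmx1 -DF mulmxA mulmx_sum_row big_enum /=.
by apply: eq_bigr => i _; rewrite -dE rowK.
Qed.

End Coordinates.
End DeRham.

(** * Coordinate fields and differentials as sections *)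

Section CoordinateSections.
Variables (R : realType) (n : nat) (M : smooth_manifold R n).
Implicit Types (c : chart R n M) (U V : opens M).
Hypothesis d_de_rham : is_de_rham (de_rham M).

Definition chart_domain c (ac : atlas M c) : opens M :=
  Opens (let: And5 od _ _ _ _ := atlasP ac in od).

Definition opens_cap U V : opens M := Opens (openI (oopen U) (oopen V)).

Lemma dcoord_frame_smooth c c' U (ac : atlas M c) (ac' : atlas M c')
    (Uc : U `<=` cdom c) (Uc' : U `<=` cdom c') i j :
  smooth_fun U (fun p => dcoord ac' Uc' i p [:: frame c j p]).
Proof.
have := form_smooth (formE (dcoord ac' Uc' i)) ac [:: j].
exact: (smooth_fun_chart ac Uc).
Qed.

Lemma dcoord_res c U V (ac : atlas M c) (Uc : U `<=` cdom c) (Vc : V `<=` cdom c)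
    (VU : V `<=` U) i p s : oset V p -> dcoord ac Vc i p s = dcoord ac Uc i p s.
Proof.
move=> Vp; rewrite -(resE VU (dcoord ac Uc i) Vp) -(app_natural _ _ (@subO _ _ _ V)).
congr (form_val (app _ _ _) p s); apply: form_ext => q r Vq.
by rewrite resE//= !asboolT//; exact: VU.
Qed.

Section Chart.
Variables (c : chart R n M) (U : opens M).
Hypotheses (ac : atlas M c) (Uc : (U : set M) `<=` cdom c).

Lemma coord_vec_subproof i : is_section U (fun p => row_mx (frame c i p) 0).
Proof.
split=> c' ac'; last first.
  move=> j; apply: (@chart_ext _ _ _ c' U (fun=> 0)) => //; last exact: chart_cst.
  by move=> p _ _; rewrite row_mxKr ev0.
(* In c' the components of d_i are dx'_j(d_i), smooth on the overlap W, the only place where c'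
   tests them. *)
pose W := opens_cap U (chart_domain ac').
have Wc : (W : set M) `<=` cdom c by move=> p [/Uc].
have Wc' : (W : set M) `<=` cdom c' by move=> p [].
exists (fun j p => dcoord ac' Wc' j p [:: frame c i p]); split=> [j|p Up dp].
  apply: smooth_sub (dcoord_frame_smooth ac ac' Wc Wc' j i ac').
  by move=> _ [p [Up dp] <-]; exists p.
by rewrite row_mxKl; exact: frame_dual.
Qed.

Definition coord_vec i : section U := Section_ (coord_vec_subproof i).

Definition coord_covec i : section U := form_section (dcoord ac Uc i).

Lemma coord_vecE i (w : dform U) p s :
  app (act (coord_vec i)) (@subset_refl _ U) w p s = w p (frame c i p :: s).
Proof. exact: cliff_vec. Qed.

Lemma coord_covec_nil i (w : dform U) p :
  app (act (coord_covec i)) (@subset_refl _ U) w p [::] = 0.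
Proof.
rewrite /= cliff_nil row_mxKl altform_cons0//; exact: form_altform (formE w) p.
Qed.

Lemma coord_vecC i j :
  act (coord_vec i) * act (coord_vec j) = - (act (coord_vec j) * act (coord_vec i)).
Proof.
apply/eqP; rewrite -addr_eq0; apply/eqP.
rewrite (@act_anticomm_cst _ _ _ _ _ _ 0) ?scale0r//.
by move=> p _; rewrite pairing_vec mulr0.
Qed.

Lemma coord_vec_sq i : act (coord_vec i) * act (coord_vec i) = 0.
Proof. by rewrite -[LHS]half_double {1}coord_vecC addNr scaler0. Qed.

Lemma coord_vec_covec i j :
  act (coord_vec i) * act (coord_covec j) + act (coord_covec j) * act (coord_vec i) =
  (i == j)%:R *: (1 : endo U).
Proof.
apply: act_anticomm_cst => p Up.
by rewrite pairing_vecl form_sectionE dcoord_frame// eq_sym.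
Qed.

Lemma coord_vec_form1 i : app (act (coord_vec i)) (@subset_refl _ U) (form1 U) = 0.
Proof. by apply: form_ext => p s Up; rewrite coord_vecE /= asboolT. Qed.

(** The d_i span each tangent space, so a form killed by all of them has only a component of degree
    0. *)
Lemma coord_vec_kernel (w : dform U) :
  (forall i, app (act (coord_vec i)) (@subset_refl _ U) w = 0) ->
  exists f : sfun U, w = app (fun_mul f) (@subset_refl _ U) (form1 U).
Proof.
move=> Aw.
have fs : smooth_fun U (fun p => w p [::]).
  by move=> c' ac'; have := form_smooth (formE w) ac' [::].
exists (Sfun fs); apply: form_ext => p [|v s] Up /=.
  by rewrite asboolT// !fctE /GRing.scale /= mulr1.
rewrite asboolT// !fctE /GRing.scale /= mulr0 (frame_dual d_de_rham ac Uc v Up).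
rewrite altform_sum; last exact: form_altform (formE w) p.
by rewrite big1// => i _; rewrite -coord_vecE Aw mulr0.
Qed.

Section Vanish.
Variables (D : endo U) (e : R).
Local Notation "f @@ w" := (app f (@subset_refl _ U) w)
  (at level 30, right associativity).
Hypothesis D_fun : forall (f : sfun U) w, D @@ fun_mul f @@ w = fun_mul f @@ D @@ w.
Hypothesis D_vec : forall i w,
  act (coord_vec i) @@ D @@ w = e *: (D @@ act (coord_vec i) @@ w).
Hypothesis D_covec : forall i w,
  D @@ act (coord_covec i) @@ w = e *: (act (coord_covec i) @@ D @@ w).
Hypothesis D_1 : forall p, oset U p -> (D @@ form1 U) p [::] = 0.

(* Since 1 = d_i dx_i + dx_i d_i and the value of D (dx_i _) at the empty
   sequence vanishes, w may be replaced by d_i dx_i w, which d_i kills. *)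
Lemma vanish_nil w p : oset U p -> (D @@ w) p [::] = 0.
Proof.
move=> Up; pose A i := act (coord_vec i); pose B i := act (coord_covec i).
have [w' w'E Aw'] : exists2 w' : dform U, (D @@ w) p [::] = (D @@ w') p [::] &
    forall i, i \in enum 'I_n -> A i @@ w' = 0.
  elim: (enum _) => [|i r [w' w'E Aw']]; first by exists w.
  exists (A i @@ B i @@ w').
    rewrite w'E; have := coord_vec_covec i i; rewrite eqxx scale1r => AB.
    rewrite -[in LHS](endo_1E (@subset_refl _ U) w') -AB endo_addE !endo_mulE.
    rewrite appD formDE.
    by rewrite [in X in _ + X = _]D_covec formZE coord_covec_nil mulr0 addr0.
  (* Directions already treated stay killed: d_j anticommutes with d_i and dx_i for j different from
     i. *)
  move=> j; have [-> _|ji] := eqVneq j i; first by rewrite -endo_mulE coord_vec_sq.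
  rewrite in_cons (negPf ji) orFb => jr; have := coord_vec_covec j i.
  rewrite (negPf ji) scale0r => /eqP; rewrite addr_eq0 => /eqP AB.
  have -> : A j @@ A i @@ B i @@ w' = - (A i @@ A j @@ B i @@ w').
    by rewrite -!endo_mulE coord_vecC mulNr endo_oppE.
  have -> : A j @@ B i @@ w' = - (B i @@ A j @@ w') by rewrite -!endo_mulE AB endo_oppE.
  by rewrite Aw'// app0 oppr0 app0 oppr0.
rewrite w'E; have [|f ->] := coord_vec_kernel (w := w').
  by move=> i; apply: Aw'; rewrite mem_enum.
by rewrite D_fun /= !fctE D_1// scaler0.
Qed.

(** Evaluation on d_i is contraction, which passes through D up to e, so every coefficient reduces
    to the empty sequence. The factor e is 1 for operators commuting with the Clifford action and -1
    for anticommuting ones. *)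
Lemma vanish w : D @@ w = 0.
Proof.
apply: form_ext => p s Up.
apply: (altform_span (b := fun i => frame c i p)) (form_altform (formE _) p) _ s.
  by move=> v; exists (fun i => dcoord ac Uc i p [:: v]); exact: frame_dual.
move=> I; elim: I w => [|i I IH] w; first exact: vanish_nil.
by rewrite /= -coord_vecE D_vec formZE IH mulr0.
Qed.

End Vanish.
End Chart.
End CoordinateSections.

(** * Operators without torsion *)

(** Jacobi identity: the commutator of t with xy + yx is the sum of those of xt + tx with y and of
    yt + ty with x. *)
Lemma anticommutator_leibniz (A : pzRingType) (t x y : A) :
  (x * t + t * x) * y = y * (x * t + t * x) ->
  (y * t + t * y) * x = x * (y * t + t * y) ->
  t * (x * y + y * x) = (x * y + y * x) * t.
Proof.
rewrite !mulrDl !mulrDr !mulrA => e1 e2.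
apply: (addrI (x * t * y + y * t * x)).
by rewrite addrACA e1 e2 [LHS]addrC [RHS]addrACA; congr (_ + _); exact: addrC.
Qed.

Section Torsion.
Variables (R : realType) (n : nat) (M : smooth_manifold R n).
Implicit Types (c : chart R n M) (U V : opens M).

Lemma has_parity_res U V (VU : V `<=` U) b (f : endo U) :
  has_parity b f -> has_parity b (endo_res VU f).
Proof.
have pE (W : opens M) (WV : W `<=` V) (WU : W `<=` U) (w : dform W) :
    app (parity V) WV w = app (parity U) WU w by exact: formP_eq.
move=> fb; apply: endo_eq => W WV w.
have := congr1 (fun g => app g (subset_trans WV VU) w) fb.
by rewrite !endo_scaleE !endo_mulE !(pE W WV (subset_trans WV VU)).
Qed.

Variable t : endo (topO M).
Hypothesis t_odd : has_parity true t.

Definition tres U : endo U := endo_res (@subO _ _ _ U) t.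
Definition anticomm U (x : section U) : endo U := act x * tres U + tres U * act x.

Lemma tres_odd U : has_parity true (tres U).
Proof. exact: has_parity_res. Qed.

Lemma gcomm_anticomm U (x : section U) : gcomm (act x) (tres U) = anticomm x.
Proof.
by rewrite (gcomm_parity (act_odd x) (tres_odd U)) /= expr1 scaleN1r opprK.
Qed.

Lemma gcomm_anticomm2 U (x y : section U) :
  gcomm (gcomm (act x) (tres U)) (act y) = anticomm x * act y - act y * anticomm x.
Proof.
have ev : has_parity false (anticomm x).
  apply: has_parityD.
    exact: (has_parityM (act_odd x) (tres_odd U)).
  exact: (has_parityM (tres_odd U) (act_odd x)).
by rewrite gcomm_anticomm (gcomm_parity ev (act_odd y)) /= expr0 scale1r.
Qed.

(** By the Clifford relation [anticomm x] is multiplication by the function 2<x, z>, which commutes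
    with the action. *)
Lemma act_torsion_free z U (x y : section U) : t = act z ->
  anticomm x * act y = act y * anticomm x.
Proof.
move=> tE; rewrite /anticomm /tres tE endo_res_act.
apply: endo_eq => V VU w; apply: form_ext => p s Vp.
set z' := section_res _ _.
have aE (u : dform V) : app (act x * act z' + act z' * act x) VU u p =
    (2 * pairing (x p) (z' p)) *: u p.
  by apply/funext => r; rewrite act_anticomm.
rewrite !endo_mulE act_anticomm.
rewrite -[RHS]/(cliff (y p) (app (act x * act z' + act z' * act x) VU w p) s).
by rewrite aE cliffZ.
Qed.

Hypothesis torsion_free : forall U (x y : section U),
  anticomm x * act y = act y * anticomm x.
Hypothesis d_de_rham : is_de_rham (de_rham M).
Variable i0 : 'I_n.

Section Chart.
Variables (c : chart R n M) (U : opens M).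
Hypotheses (ac : atlas M c) (Uc : (U : set M) `<=` cdom c).
Local Notation "f @@ w" := (app f (@subset_refl _ U) w)
  (at level 30, right associativity).
Local Notation vec := (coord_vec d_de_rham ac Uc).
Local Notation covec := (coord_covec ac Uc).

Lemma tres_fun (f : sfun U) : tres U * fun_mul f = fun_mul f * tres U.
Proof.
(* The index [i0] provides the coordinate direction in which f is written as an anticommutator. *)
pose x := vec i0; pose y := section_scale f (covec i0).
have <- : act x * act y + act y * act x = fun_mul f.
  apply: act_anticomm_fun => p Up; rewrite /= pairing_vecl linearZ /= -[_ *: _]addr0.
  by rewrite ev_linear_l ev0 addr0 form_sectionE dcoord_frame// eqxx mulr1.
by apply: anticommutator_leibniz; exact: torsion_free.
Qed.

Lemma anticomm_fun (x : section U) (f : sfun U) :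
  anticomm x * fun_mul f = fun_mul f * anticomm x.
Proof.
have tf := tres_fun f; have xf := fun_mulC f x.
by rewrite /anticomm mulrDl mulrDr -!mulrA tf -xf !mulrA tf xf.
Qed.

(** With h the degree 0 part of [anticomm x] on 1, [vanish] applies with e = 1 to the difference of
    [anticomm x] and h. *)
Lemma anticomm_scalar (x : section U) w p s : oset U p ->
  (anticomm x @@ w) p s = (anticomm x @@ form1 U) p [::] * w p s.
Proof.
move=> Up; set u := anticomm x @@ form1 U.
have hs : smooth_fun U (fun p => u p [::]).
  by move=> c' ac'; have := form_smooth (formE u) ac' [::].
pose h := Sfun hs.
suff /eqP : (anticomm x - fun_mul h) @@ w = 0.
  by rewrite endo_addE endo_oppE subr_eq0 => /eqP ->.
have comm (g : endo U) : anticomm x * g = g * anticomm x ->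
    fun_mul h * g = g * fun_mul h ->
    (anticomm x - fun_mul h) * g = g * (anticomm x - fun_mul h).
  by move=> e1 e2; rewrite mulrBl mulrBr e1 e2.
apply: (@vanish _ _ _ d_de_rham _ _ ac Uc _ 1).
- move=> f v; rewrite -!endo_mulE comm//; first exact: anticomm_fun.
  apply: endo_eq => V VU v'; apply: form_ext => q r Vq /=.
  by rewrite !fctE /GRing.scale /= mulrCA.
- move=> i v.
  by rewrite scale1r -!endo_mulE (comm _ (torsion_free _ _) (fun_mulC _ _)).
- move=> i v.
  by rewrite scale1r -!endo_mulE (comm _ (torsion_free _ _) (fun_mulC _ _)).
- move=> q Uq; rewrite endo_addE endo_oppE formDE formNE -/u /= asboolT//.
  by rewrite !fctE /GRing.scale /= mulr1 subrr.
Qed.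

(* The coefficient of d_i in the section z such that t = act z. *)
Definition tcoef i p : R := (tres U @@ act (covec i) @@ form1 U) p [::].

Lemma act_covec_form1 i p s : oset U p ->
  (act (covec i) @@ form1 U) p s = if s is [:: v] then dcoord ac Uc i p [:: v] else 0.
Proof.
move=> Up; rewrite /= cliff_covec; last exact: form_altform (formE (form1 U)) p.
case: s => [|v s]; first by rewrite /wedge big_nil.
rewrite wedge_cons ev_row -form_basis /wedge asboolT//=.
rewrite [X in _ - X]big1 ?subr0; last by move=> j _; rewrite !mulr0.
by case: s => [|v' s]; rewrite /= ?mulr1 ?mulr0.
Qed.

End Chart.

(** Since 1 is even and t is odd, the value equals its own negative. *)
Lemma tres_form1_nil U p : oset U p ->
  app (tres U) (@subset_refl _ U) (form1 U) p [::] = 0.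
Proof.
move=> Up; have p1 : app (parity U) (@subset_refl _ U) (form1 U) = form1 U.
  apply: form_ext => q s Uq /=; rewrite asboolT//.
  by case: s => [|v s]; rewrite ?mulr0// expr0 mul1r.
have := congr1 (fun f => app f (@subset_refl _ U) (form1 U) p [::]) (tres_odd U).
rewrite endo_scaleE !endo_mulE p1 formZE [LHS]/= expr0 mul1r expr1 mulN1r.
by set a := form_val _ _ _; lra.
Qed.

Lemma tcoef_res c U V (ac : atlas M c) (Uc : U `<=` cdom c) (Vc : V `<=` cdom c)
    (VU : V `<=` U) i p : oset V p -> tcoef ac Vc i p = tcoef ac Uc i p.
Proof.
pose VO := subset_trans (@subset_refl _ V) (@subO _ _ _ V).
move=> Vp; rewrite /tcoef /= -(resE VU _ Vp) -(app_natural _ _ VO).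
congr (form_val (app _ _ _) p _); apply: form_ext => q s Vq.
rewrite resE// act_covec_form1// act_covec_form1//; last exact: VU.
by case: s => [|v []]//; exact: dcoord_res.
Qed.

(** Apply t to dx_i = sum_j dx_i(d'_j) dx'_j; it commutes with the function coefficients. *)
Lemma tcoef_change c c' U (ac : atlas M c) (ac' : atlas M c') (Uc : U `<=` cdom c)
    (Uc' : U `<=` cdom c') i p : oset U p ->
  tcoef ac Uc i p =
  \sum_(j <- enum 'I_n) dcoord ac Uc i p [:: frame c' j p] * tcoef ac' Uc' j p.
Proof.
move=> Up; pose a j : sfun U := Sfun (dcoord_frame_smooth ac' ac Uc' Uc i j).
pose u c (ac : atlas M c) Uc i :=
  app (act (coord_covec ac Uc i)) (@subset_refl _ U) (form1 U).
have uE : u c ac Uc i = \sum_(j <- enum 'I_n)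
    app (fun_mul (a j)) (@subset_refl _ U) (u c' ac' Uc' j).
  apply: form_ext => q s Uq; rewrite form_sumE act_covec_form1//.
  under eq_bigr do rewrite -[form_val _ _ _]/(a _ q * u c' ac' Uc' _ q s).
  under eq_bigr do rewrite act_covec_form1//.
  case: s => [|v [|v' s]]; try by rewrite big1// => j _; rewrite mulr0.
  rewrite {1}(frame_dual d_de_rham ac' Uc' v Uq).
  rewrite altform_sum; last exact: form_altform (formE (dcoord ac Uc i)) q.
  by apply: eq_bigr => j _; rewrite mulrC.
rewrite /tcoef -[app (act _) _ _]/(u c ac Uc i) uE app_sum form_sumE.
apply: eq_bigr => j _; have tf := tres_fun ac Uc (a j).
by rewrite -endo_mulE tf.
Qed.

Definition tvec c U (ac : atlas M c) (Uc : U `<=` cdom c) p :=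
  \sum_(i <- enum 'I_n) tcoef ac Uc i p *: frame c i p.

(** Coefficients and frames transform by the same matrix dx_i(d'_j) in opposite directions. *)
Lemma tvec_change c c' U (ac : atlas M c) (ac' : atlas M c') (Uc : U `<=` cdom c)
    (Uc' : U `<=` cdom c') p : oset U p -> tvec ac Uc p = tvec ac' Uc' p.
Proof.
move=> Up; have tE i := tcoef_change ac ac' Uc Uc' i Up.
transitivity (\sum_(i <- enum 'I_n) \sum_(j <- enum 'I_n)
    (dcoord ac Uc i p [:: frame c' j p] * tcoef ac' Uc' j p) *: frame c i p).
  by apply: eq_bigr => i _; rewrite -scaler_suml -tE.
rewrite exchange_big /=; apply: eq_bigr => j _.
rewrite [frame c' j p in RHS](frame_dual d_de_rham ac Uc _ Up) scaler_sumr.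
by apply: eq_bigr => i _; rewrite scalerA mulrC.
Qed.

Lemma tvec_res c U V (ac : atlas M c) (Uc : U `<=` cdom c) (Vc : V `<=` cdom c)
    (VU : V `<=` U) p : oset V p -> tvec ac Vc p = tvec ac Uc p.
Proof. by move=> Vp; apply: eq_bigr => i _; rewrite (tcoef_res ac Uc Vc VU). Qed.

(** The charts chosen at the points glue the local vectors; by [tvec_atE] any other chart gives the
    same result, whence smoothness. *)
Definition tvec_at p : 'rV[R]_n :=
  tvec (U := chart_domain (chart_atP p).1) (chart_atP p).1 (@subset_refl _ _) p.

Lemma tvec_atE c U (ac : atlas M c) (Uc : U `<=` cdom c) p : oset U p ->
  tvec_at p = tvec ac Uc p.
Proof.
move=> Up; have [ac' dp] := chart_atP p.
pose W := opens_cap U (chart_domain (chart_atP p).1).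
have WU : W `<=` U by move=> q [].
have Wc : W `<=` cdom c by move=> q /WU /Uc.
have Wc' : W `<=` cdom (chart_at M p) by move=> q [].
have Wp : oset W p by [].
rewrite -(tvec_res ac Uc Wc WU Wp) (tvec_change ac (chart_atP p).1 Wc Wc' Wp).
have WD : W `<=` chart_domain (chart_atP p).1 by move=> q [].
by apply/esym; exact: (tvec_res (U := chart_domain (chart_atP p).1) _ _ _ WD).
Qed.

Definition tform : dform (topO M) := app t (@subO _ _ _ _) (form1 (topO M)).

(** In each chart the vector components are the degree 0 parts of the forms t(dx_i), hence
    smooth. *)
Lemma torsion_free_subproof : is_section (topO M)
  (fun p => row_mx (tvec_at p) (\row_j tform p [:: delta_mx 0 j])).
Proof.
have [_ xc] := sectionP (form_section tform).
split=> [c ac|c ac i]; last first.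
  apply: chart_ext (xc c ac i) => // p _ _.
  by rewrite !row_mxKr.
pose Uc := @subset_refl _ (chart_domain ac).
exists (fun i p => tcoef ac Uc i p); split=> [i|p _ dp].
  pose u := app (act (coord_covec ac Uc i)) Uc (form1 (chart_domain ac)).
  have := form_smooth (formE (app (tres (chart_domain ac)) Uc u)) ac [::].
  by apply: smooth_sub => _ [p [_ dp] <-]; exists p.
by rewrite row_mxKl (tvec_atE ac Uc).
Qed.

Lemma torsion_free_section : exists z, t = act z.
Proof.
pose z := Section_ torsion_free_subproof; exists z.
apply: endo_eq => V VO w; apply: form_ext => p s Vp.
have [ac dp] := chart_atP p; set c := chart_at M p in ac dp.
(* Around p both a chart and the restriction of w are available on U, so that [vanish] can be
   used. *)
pose U := opens_cap V (chart_domain ac).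
have UV : U `<=` V by move=> q [].
have Uc : U `<=` cdom c by move=> q [].
have Up : oset U p by [].
pose zU := section_res (@subO _ _ _ U) z.
suff D0 (u : dform U) : app (tres U - act zU) (@subset_refl _ U) u = 0.
  apply/eqP; rewrite -subr_eq0 -formNE -formDE -endo_oppE -endo_addE; apply/eqP.
  rewrite -(resE UV (app (t - act z) VO w) Up) -(app_natural _ VO (@subO _ _ _ U)).
  transitivity (app (tres U - act zU) (@subset_refl _ U) (res UV w) p s);
    last by rewrite D0.
  rewrite !endo_addE !endo_oppE -endo_res_act.
  by congr (form_val (_ - _) p s); exact: app_irr.
have tformE q s' : oset U q ->
    app (tres U) (@subset_refl _ U) (form1 U) q s' = tform q s'.
  move=> Uq; rewrite -(resE (@subO _ _ _ U) tform Uq).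
  pose UO := subset_trans (@subset_refl _ U) (@subO _ _ _ U).
  rewrite -(app_natural t (@subO _ _ _ _) UO).
  congr (form_val (app _ _ _) q s'); apply: form_ext => r s1 Ur.
  by rewrite resE//= !asboolT.
(* The anticommutators of x with t and with z are multiplications by functions; comparing these
   functions suffices. *)
have anti (x : section U) (v : dform U) :
    (forall q, oset U q ->
      app (anticomm x) (@subset_refl _ U) (form1 U) q [::] = 2 * pairing (x q) (z q)) ->
    app (act x * (tres U - act zU) + (tres U - act zU) * act x)
      (@subset_refl _ U) v = 0.
  move=> xz; rewrite mulrBr mulrBl addrACA -opprD endo_addE endo_oppE.
  apply/eqP; rewrite subr_eq0; apply/eqP; apply: form_ext => q s' Uq.
  by rewrite (anticomm_scalar ac Uc)// xz// act_anticomm.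
apply: (@vanish _ _ _ d_de_rham _ _ ac Uc _ (-1)).
- move=> f v; have tf := tres_fun ac Uc f; have zf := fun_mulC f zU.
  by rewrite -!endo_mulE mulrBl mulrBr tf zf.
- move=> i v; apply/eqP; rewrite scaleN1r -subr_eq0 opprK -!endo_mulE -endo_addE.
  apply/eqP.
  (* As d_i kills 1, the function is t(1) evaluated on d_i, which is the covector part of z on
     d_i. *)
  apply: anti => q Uq; rewrite /anticomm endo_addE !endo_mulE coord_vec_form1 app0.
  rewrite addr0 coord_vecE tformE// pairing_vecl row_mxKr ev_row.
  by rewrite [LHS]form_basis.
- move=> i v; apply/eqP; rewrite scaleN1r -subr_eq0 opprK -!endo_mulE -endo_addE.
  rewrite addrC; apply/eqP.
  (* The degree 0 part of dx_i t(1) vanishes; what remains is that of t(dx_i), which is dx_i on the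
     vector part of z. *)
  apply: anti => q Uq; rewrite /anticomm endo_addE !endo_mulE formDE.
  rewrite coord_covec_nil add0r.
  rewrite pairing_covecl ev_row -form_basis row_mxKl.
  rewrite (tvec_atE ac Uc)// altform_sum;
    last exact: form_altform (formE (dcoord ac Uc i)) q.
  rewrite big_enum (bigD1 i)//= dcoord_frame// eqxx mulr1 big1 ?addr0// => j ji.
  by rewrite dcoord_frame// eq_sym (negPf ji) mulr0.
(* The form t(1) has no degree 0 part by parity, and neither has z(1), since 1 vanishes on nonempty
   sequences. *)
- move=> q Uq; rewrite endo_addE endo_oppE formDE formNE tres_form1_nil// sub0r.
  by rewrite [X in - X]cliff_nil /= asboolT// oppr0.
Qed.

End Torsion.

(** * Minimal structures *)

Section Minimal.
Variables (R : realType) (n : nat) (M : smooth_manifold R n).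
Variables (phi : gen_endo M) (P : {poly R}).
Implicit Types (f g : endo (topO M)).

Lemma endo_res_top (VO : topO M `<=` topO M) f : endo_res VO f = f.
Proof. by apply: endo_eq => V VO' w; exact: (app_irr f). Qed.

Lemma tilde_even : part true (tilde phi) = 0.
Proof.
have [[psi psiP]|no_tilde] := pselect (exists psi, is_tilde phi psi).
  by have [] := @xgetPex _ 0 [set psi | is_tilde phi psi] (ex_intro _ psi psiP).
(* The default value 0 is even. *)
rewrite /tilde xgetPN; last by move=> psi psiP; apply: no_tilde; exists psi.
by rewrite /part !(mulr0, mul0r) scaler0 addr0 scaler0.
Qed.

Lemma adE g : ad (tilde phi) g = tilde phi * g - g * tilde phi.
Proof. exact: gcomm_even tilde_even. Qed.

Lemma ad_act (x : section (topO M)) : exists y, ad (tilde phi) (act x) = act y.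
Proof.
have [[psi psiP]|no_tilde] := pselect (exists psi, is_tilde phi psi).
  have [_ _ tx _] := @xgetPex _ 0 [set psi | is_tilde phi psi] (ex_intro _ psi psiP).
  by exists (gapp phi x); rewrite -tx endo_res_top.
(* For the default value 0 the bracket is 0, the action of the zero section. *)
exists (section0 (topO M)); rewrite adE /tilde xgetPN.
  by rewrite mul0r mulr0 subrr act0.
by move=> psi psiP; apply: no_tilde; exists psi.
Qed.

Lemma ad_linear : linear (ad (tilde phi)).
Proof.
move=> a f g; rewrite !adE mulrDr mulrDl endo_scaleAr endo_scaleAl opprD addrACA.
by rewrite scalerBr.
Qed.

Lemma ad0 : ad (tilde phi) 0 = 0.
Proof. by rewrite adE mulr0 mul0r subrr. Qed.

(** The operator d is odd, and brackets with the even [tilde phi] preserve parity. *)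
Lemma min_op_odd : is_de_rham (de_rham M) -> has_parity true (min_op phi P).
Proof.
move=> dd; rewrite /min_op /poly_op; elim/big_rec: _ => [|i g _ godd].
  exact: has_parity0.
apply: has_parity_lin => //; elim: (nat_of_ord i) => [|k IH] /=.
  exact: de_rham_odd.
have t_even := even_has_parity tilde_even.
rewrite adE; apply: has_parityD; first exact: (has_parityM t_even IH).
by apply: has_parityN; exact: (has_parityM IH t_even).
Qed.

Lemma min_op0 : de_rham M = 0 -> min_op phi P = 0.
Proof.
move=> d0; rewrite /min_op /poly_op d0 big1// => i _.
suff -> : iter i (ad (tilde phi)) 0 = 0 by rewrite scaler0.
by elim: (nat_of_ord i) => //= k ->; exact: ad0.
Qed.

Lemma minimalP : 'I_n -> minimal phi P <-> exists z, min_op phi P = act z.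
Proof.
move=> i0; split=> [mP|[z tE] U x y].
  have [[d dd]|no_d] := pselect (exists d, is_de_rham (M := M) d); last first.
    (* Here [de_rham] is 0 by default, and so is [min_op]. *)
    exists (section0 _); rewrite act0 min_op0// /de_rham xgetPN// => d dd.
    by apply: no_d; exists d.
  have {}dd : is_de_rham (de_rham M).
    exact: (@xgetPex _ 0 [set d | is_de_rham d] (ex_intro _ d dd)).
  have todd := min_op_odd dd.
  apply: (torsion_free_section todd _ dd i0) => U x y.
  apply/eqP; rewrite -subr_eq0 -gcomm_anticomm2//.
  by apply/eqP; exact: mP.
have todd : has_parity true (min_op phi P) by rewrite tE; exact: act_odd.
rewrite /min_torsion -/(tres _ U) gcomm_anticomm2//.
by rewrite (act_torsion_free x y tE) subrr.
Qed.

End Minimal.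

(** * Complexified operators and sections *)

Section Complex.
Variables (R : realType) (n : nat) (M : smooth_manifold R n) (phi : gen_endo M).
Local Notation E := (cplx (endo (topO M))).

Lemma ad_cplx_linear : linear (ad_cplx (tilde phi) : E -> E).
Proof.
have adl := ad_linear phi.
have adZ a f : ad (tilde phi) (a *: f) = a *: ad (tilde phi) f.
  by have := adl a f 0; rewrite addr0 ad0 addr0.
have adD f g : ad (tilde phi) (f + g) = ad (tilde phi) f + ad (tilde phi) g.
  by have := adl 1 f g; rewrite !scale1r.
have adN f : ad (tilde phi) (- f) = - ad (tilde phi) f.
  by have := adZ (-1) f; rewrite !scaleN1r.
move=> [a b] [f1 f2] [g1 g2]; rewrite /ad_cplx /=.
by congr (_, _) => /=; rewrite !(adD, adN, adZ).
Qed.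

Lemma in_TMC0 : in_TMC (0 : E).
Proof. by exists (section0 _), (section0 _); rewrite act0. Qed.

Lemma in_TMC_comb (a : R[i]) (g h : E) : in_TMC g -> in_TMC h -> in_TMC (a *: g + h).
Proof.
case: a => a b [x [y ->]] [x' [y' ->]].
(* The witnesses are the real and imaginary parts of (a + ib)(x + iy) + (x' + iy'). *)
exists (section_comb a x (section_comb (- b) y x')).
exists (section_comb a y (section_comb b x y')).
by rewrite !act_comb !addrA scaleNr.
Qed.

Lemma in_TMC_ad (g : E) : in_TMC g -> in_TMC (ad_cplx (tilde phi) g).
Proof.
move=> [x [y ->]]; have [x' x'E] := ad_act phi x; have [y' y'E] := ad_act phi y.
by exists x', y'; rewrite /ad_cplx /= x'E y'E.
Qed.

End Complex.

(** All points share the minimal polynomial P, so each of its roots is an eigenvalue already at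
    [p0]. *)
Lemma spectrum_roots (R : realType) (n : nat) (M : smooth_manifold R n)
    (phi : gen_endo M) (P : {poly R}) (p0 : M) l :
  (forall p, is_minpoly (phi p) P) ->
  spectrum phi l <-> root (map_poly (real_complex R) P) l.
Proof.
move=> mP; split=> [[p]|Pl]; first by rewrite (minpoly_root _ _ (mP p)).
by exists p0; rewrite (minpoly_root _ _ (mP p0)).
Qed.

Theorem theorem115 (R : realType) (n : nat) (M : smooth_manifold R n)
    (phi : gen_endo M) (P : {poly R}) (phiP : gen_poly_structure phi P) :
  minimal phi P <->
  exists dl : R[i] -> cplx (endo (topO M)),
    to_cplx (de_rham M) = \sum_(l \in spectrum phi) dl l /\
    forall l, spectrum phi l ->
      in_TMC (iter (mult P l)
        (fun g : cplx (endo (topO M)) => ad_cplx (tilde phi) g - l *: g) (dl l)).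
Proof.
have [_ mP sP minP] := phiP.
have [[p0 _]|M0] := pselect (exists p : M, True); last first.
  (* On an empty manifold all operators over an open set coincide and the spectrum is empty, so both
     sides hold. *)
  have endo0 (U : opens M) (f g : endo U) : f = g.
    apply: endo_eq => V VU w; apply: formP_eq => p s.
    by case: M0; exists p.
  split=> [_|_ U x y]; last exact: endo0.
  exists (fun=> 0); split=> [|l [p _]]; last by case: M0; exists p.
  by case: (\sum_(_ \in _) _) => a b; congr (_, _); exact: endo0.
(* In dimension 0 the constant 1 would annihilate [phi p0], so P would divide 1, against its
   positive degree. *)
have i0 : 'I_n.
  case: n M phi phiP {minP} p0 (minP p0) => [|n] M phi _ p0;
    last by move=> *; exact: ord0.
  move=> [_ PE]; have : P %| 1 by apply/PE => v; exact: thinmx0.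
  by rewrite dvdp1 => /eqP s1; rewrite s1 in sP.
rewrite (minimalP _ _ i0).
have [l [rs [us rootE QE]]] := map_poly_prod_roots mP sP.
(* The spectrum is the finite list of roots of P, which turns the sum over it into a sum over a
   list. *)
have specE : spectrum phi = [set` (l :: rs)].
  apply/seteqP; split=> k /=.
    by move=> /(spectrum_roots p0 _ minP); rewrite rootE.
  by move=> krs; apply/(spectrum_roots p0 _ minP); rewrite rootE.
have sumE (dl : R[i] -> cplx (endo (topO M))) :
    \sum_(k \in spectrum phi) dl k = \sum_(k <- l :: rs) dl k.
  by rewrite specE -fsbig_seq.
pose A : cplx (endo (topO M)) -> cplx (endo (topO M)) := ad_cplx (tilde phi).
have Al : linear A := ad_cplx_linear phi.
(* The factored P, applied to the complexified d, gives the minimal operator with imaginary part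
   0. *)
have opE : poly_op A (\prod_(k <- l :: rs) ('X - k%:P) ^+ mult P k)
    (to_cplx (de_rham M)) = to_cplx (min_op phi P).
  by rewrite -QE -map_poly_op// ad0.
have TA := @in_TMC_ad R n M phi.
have T0 := @in_TMC0 R n M.
have Tl := @in_TMC_comb R n M.
split=> [[z tE]|[dl [dE dT]]].
  have [|dl [dE dT]] := primary_decomposition Al T0 Tl TA us (m := mult P)
    (v := to_cplx (de_rham M)).
    by rewrite opE tE; exists z, (section0 _); rewrite act0.
  exists dl; rewrite sumE; split=> // k; rewrite specE => /dT.
  by rewrite poly_op_XsubC_exp.
have [|x [y]] := primary_recomposition Al T0 Tl TA (rs := l :: rs)
  (m := mult P) (u := dl).
  move=> k krs; rewrite poly_op_XsubC_exp//; apply: dT.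
  by rewrite specE.
(* The real component of the membership exhibits [min_op] as the action of x. *)
by rewrite -sumE -dE opE => -[-> _]; exists x.
Qed.
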